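(* Let $K\subset\mathbb{C}^n$ be a compact, non-pluripolar set, let $U$ be an $s$-dimensional complex Hermitian space with fixed orthonormal basis $u_1,\dots,u_s$, and let $w=(w_1,\dots,w_s)$ with $w_l\in\mathscr{C}^0(K,\,]0,+\infty[)$ for each $l=1,\dots,s$. Then the limit $$\delta^w(K,U):=\lim_{r\to\infty}\delta^{w,r}(K,U)$$ exists and $$\delta^w(K,U)=\Big(\prod_{l=1}^s\delta^{w_l}(K)\Big)^{1/s},$$ where $\delta^{w,r}(K,U)$ is the $r$-th weighted diameter of $K$ with respect to $U$ and $\delta^{w_l}(K)$ is the scalar weighted transfinite diameter of $K$ with weight $w_l$.
   Context: Notation. $m_r:=\binom{n+r}{n}=\dim\mathscr{P}_{r,n}\mathbb{C}$, where $\mathscr{P}_{r,n}\mathbb{C}$ is the space of complex polynomials of degree at most $r$ in $n$ variables; $N:=s\,m_r$; $\ell_r:=\sum_{k=1}^r k(m_k-m_{k-1})$. Basis. $q_1,\dots,q_N$ is an enumeration (the order is immaterial below) of the $U$-valued polynomials $x\mapsto x^{\beta}u_i$ with $\beta\in\mathbb{N}^n$, $|\beta|\le r$, $i\in\{1,\dots,s\}$. Coordinate-wise product. For $a=\sum_i a_iu_i$ and $b=\sum_i b_iu_i$ one sets $a\odot b:=\sum_i a_ib_iu_i$. The weight $w$ is identified with $\sum_i w_iu_i$, and $w^r:=\sum_i w_i^r u_i$, so $(q\odot w^r)(x)=\sum_i q_i(x)w_i(x)^ru_i$ for $q=\sum_i q_iu_i$. Vector measures. $\mathscr{C}^0(K,U)$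 is the Banach space of continuous functions $K\to U$ with norm $\|\omega\|_{K,U}=\max_{x\in K}\|\omega(x)\|_U$, and $\mathcal{M}(K,U):=(\mathscr{C}^0(K,U))^*$ is its dual with the operator norm $\|\cdot\|$. The $r$-th weighted diameter of $K$ with respect to $U$ is $$\delta^{w,r}(K,U):=\Big[\max_{T_1,\dots,T_N\in\mathcal{M}(K,U),\ \|T_i\|=1}\big|\det[T_i(q_j\odot w^r)]_{i,j=1,\dots,N}\big|\Big]^{1/(s\,\ell_r)}.$$ Scalar weighted transfinite diameter. For continuous $\omega_0:K\to\,]0,+\infty[$, $$\delta^{\omega_0}(K):=\lim_{r\to\infty}\Big[\max_{(x_1,\dots,x_{m_r})\in K^{m_r}}|\mathrm{Vdm}(x_1,\dots,x_{m_r})|\,\omega_0(x_1)^r\cdots\omega_0(x_{m_r})^r\Big]^{1/\ell_r},$$ where $\mathrm{Vdm}(x_1,\dots,x_{m_r})=\det[x_i^{\alpha(j)}]_{i,j=1,\dots,m_r}$ and $\alpha(1),\dots,\alpha(m_r)$ enumerate the multi-indices $\alpha\in\mathbb{N}^n$ with $|\alpha|\le r$. This limit is known to exist (Bloom–Levenberg). A set is pluripolar if it is contained in the $-\infty$ set of a plurisubharmonic function on $\mathbb{C}^n$ that is not identically $-\infty$. *)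

(* Defs.v *)
From HB Require Import structures.
From mathcomp Require Import all_boot all_order all_algebra.
From mathcomp Require Import all_classical all_reals all_analysis.
From mathcomp Require Import complex.

Set Implicit Arguments.
Unset Strict Implicit.
Unset Printing Implicit Defensive.

Import Order.TTheory GRing.Theory Num.Def Num.Theory.
Import numFieldNormedType.Exports.

Local Open Scope classical_set_scope.
Local Open Scope ring_scope.
Local Open Scope complex_scope.

Local Set Warnings "-redundant-canonical-projection".

HB.instance Definition _ (R : realType) := NormedModule.copy R[i] R[i]^o.

(* [`|v|] takes its values in [R[i]]; [rnorm v] is the same number in [R]. *)
Definition rnorm (R : realType) (V : normedZmodType R[i]) (v : V) : R :=
  complex.Re `|v|.

Section Pluripolar.
Context {R : realType}.

Definition upper_semicontinuous (X : topologicalType) (f : X -> \bar R) :=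
  lower_semicontinuous (fun x => - f x)%E.

Definition circle_mean (v : R[i] -> \bar R) (z : R[i]) (rho : R) : \bar R :=
  (((2 * pi)^-1)%:E *
   \int[lebesgue_measure]_(t in `[0%R, (2 * pi)%R])
     v (z + rho%:C * (cos t +i* sin t))%R)%E.

(* Here and in [psh] the function constantly equal to -oo is allowed. *)
Definition subharmonic (v : R[i] -> \bar R) : Prop :=
  [/\ upper_semicontinuous v,
      forall z, (v z < +oo)%E &
      forall (z : R[i]) (rho : R), 0 < rho -> (v z <= circle_mean v z rho)%E].

Definition psh (n : nat) (v : 'rV[R[i]]_n -> \bar R) : Prop :=
  [/\ upper_semicontinuous v,
      forall x, (v x < +oo)%E &
      forall a b : 'rV[R[i]]_n, subharmonic (fun z : R[i] => v (a + z *: b))].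

Definition pluripolar (n : nat) (E : set 'rV[R[i]]_n) : Prop :=
  exists v : 'rV[R[i]]_n -> \bar R,
    [/\ psh v, exists x, v x != -oo%E & E `<=` [set x | v x = -oo%E]].

End Pluripolar.

Section Monomials.
Variables n r : nat.

Definition mdim : nat := 'C(n + r, n).

(* [alpha] enumerates the multi-indices of length at most r. *)
Definition alpha (j : 'I_mdim) : n.-tuple 'I_r.+1 :=
  enum_val (cast_ord (esym (card_partial_ord_partitions n r)) j).

Definition monom (F : comNzRingType) (j : 'I_mdim) (x : 'rV[F]_n) : F :=
  \prod_(i < n) x 0 i ^+ tnth (alpha j) i.

End Monomials.

(* The natural-number subtraction is exact since mdim n is nondecreasing. *)
Definition ell (n r : nat) : nat :=
  (\sum_(1 <= k < r.+1) k * (mdim n k - mdim n k.-1))%N.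

Section ScalarDiameter.
Context {R : realType} {n : nat} {K : set 'rV[R[i]]_n}.
Implicit Type omega : K -> R.

Definition vdm (r : nat) (x : 'I_(mdim n r) -> 'rV[R[i]]_n) : R[i] :=
  \det (\matrix_(i, j) monom j (x i)).

(* The maximum over K^m is attained, hence equal to this supremum. *)
Definition scalar_diam omega (r : nat) : R :=
  sup [set rnorm (vdm (fun i => set_val (x i))) * \prod_i omega (x i) ^+ r
      | x in [set: 'I_(mdim n r) -> K]] `^ (ell n r)%:R^-1.

Definition transfinite_diam omega : R := limn (scalar_diam omega).

End ScalarDiameter.

(* The Hermitian space (U, h), normed by v |-> sqrt (h v v). *)
Definition hermspace (R : realType) (U : vectType R[i])
  (h : {dot U for conjC}) : Type := U.

Section HermitianSpace.
Context {R : realType} {U : vectType R[i]} (h : {dot U for conjC}).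

HB.instance Definition _ := Vector.copy (hermspace h) U.

Let hnorm (v : hermspace h) : R[i] := sqrtC (h v v).

Let hnormD v w : hnorm (v + w) <= hnorm v + hnorm w.
Proof. by have [] := triangle_lerif h v w. Qed.

Let hnormZ (l : R[i]) v : hnorm (l *: v) = `|l| * hnorm v.
Proof.
by rewrite /hnorm dnormZ rootCMl ?exprn_ge0// sqrCK.
Qed.

Let hnorm0_eq0 v : hnorm v = 0 -> v = 0.
Proof. by move/eqP; rewrite sqrt_dnorm_eq0 => /eqP. Qed.

HB.instance Definition _ := Lmodule_isNormed.Build R[i] (hermspace h)
  hnormD hnormZ hnorm0_eq0.

End HermitianSpace.

Section ContinuousFunctions.
Context {R : realType} {X : topologicalType} {V : normedModType R[i]}.
Local Notation C0 := (continuousType X V).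
Implicit Types f g : C0.

(* [continuousType X V] has no module structure in the library. *)
Let c0_zero : C0 := mkcts (fun x => @cst_continuous X V 0 x).
Let c0_opp f : C0 := mkcts (fun x => continuousN (@cts_fun _ _ f x)).
Let c0_add f g : C0 :=
  mkcts (fun x => continuousD (@cts_fun _ _ f x) (@cts_fun _ _ g x)).
Let c0_scale (a : R[i]) f : C0 :=
  mkcts (fun x => continuousZ (@cst_continuous X R[i] a x) (@cts_fun _ _ f x)).

Let c0_addA : associative c0_add.
Proof. by move=> f g k; apply/continuousEP => x; exact: addrA. Qed.
Let c0_addC : commutative c0_add.
Proof. by move=> f g; apply/continuousEP => x; exact: addrC. Qed.
Let c0_add0 : left_id c0_zero c0_add.
Proof. by move=> f; apply/continuousEP => x; exact: add0r. Qed.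
Let c0_addN : left_inverse c0_zero c0_opp c0_add.
Proof. by move=> f; apply/continuousEP => x; exact: addNr. Qed.

HB.instance Definition _ :=
  GRing.isZmodule.Build C0 c0_addA c0_addC c0_add0 c0_addN.

Let c0_scaleA a b f : c0_scale a (c0_scale b f) = c0_scale (a * b) f.
Proof. by apply/continuousEP => x; exact: scalerA. Qed.
Let c0_scale1 : left_id 1 c0_scale.
Proof. by move=> f; apply/continuousEP => x; exact: scale1r. Qed.
Let c0_scaleDr : right_distributive c0_scale +%R.
Proof. by move=> a f g; apply/continuousEP => x; exact: scalerDr. Qed.
Let c0_scaleDl f : {morph c0_scale^~ f : a b / a + b}.
Proof. by move=> a b; apply/continuousEP => x; exact: scalerDl. Qed.

HB.instance Definition _ := GRing.Zmodule_isLmodule.Build R[i] C0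
  c0_scaleA c0_scale1 c0_scaleDr c0_scaleDl.

(* [supnorm] is the norm of C0 when X is compact; elsewhere [sup] may be junk. *)
Definition supnorm f : R := sup [set rnorm (f x) | x in [set: X]].

Definition bounded_functional (T : {scalar C0}) : Prop :=
  exists M : R, forall f, rnorm (T f) <= M * supnorm f.

Definition opnorm (T : {scalar C0}) : R :=
  sup [set rnorm (T f) | f in [set f : C0 | supnorm f <= 1]].

End ContinuousFunctions.

Lemma continuous_exp (F : numFieldType) (X : topologicalType) (f : X -> F)
  (k : nat) : continuous f -> continuous (fun x => f x ^+ k).
Proof.
move=> cf; elim: k => [|k IHk] x; first exact: cst_continuous.
rewrite (_ : (fun _ => _) = f \* (fun y => f y ^+ k)); last first.
  by apply/funext => y; rewrite exprS.
by apply: continuousM; [exact: cf|exact: IHk].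
Qed.

Lemma real_complex_continuous (R : realType) : continuous (real_complex R).
Proof.
move=> x; apply/cvgrPdist_lt => e e0.
have eR : e = (complex.Re e)%:C by move: e0; case: e => a b; rewrite ltcE => /= /andP[/eqP->].
have e0' : 0 < complex.Re e by rewrite -ltcR -eR.
near=> y.
rewrite -raddfB normc_def /= expr0n addr0 sqrtr_sqr eR ltcR.
near: y; move/cvgrPdist_lt : (@cvg_id _ (nbhs x)); exact.
Unshelve. all: end_near. Qed.

Section WeightedDiameter.
Context {R : realType} {n s : nat} {K : set 'rV[R[i]]_n}.
Context {U : vectType R[i]} (h : {dot U for conjC}) (u : s.-tuple U).
Variable w : 'I_s -> continuousType K R.

Definition odot (a b : U) : U :=
  \sum_(i < s) (coord u i a * coord u i b) *: tnth u i.

Definition wpow (r : nat) (x : K) : U :=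
  \sum_(i < s) (w i x ^+ r)%:C *: tnth u i.

(* The index k stands for a pair (i, j), and [qpoly k] is x |-> x^alpha(j) u_i. *)
Definition qpoly (r : nat) (k : 'I_(s * mdim n r)) (x : 'rV[R[i]]_n) : U :=
  let ij := enum_val (cast_ord (esym (mxvec_cast s (mdim n r))) k) in
  monom ij.2 x *: tnth u ij.1.

Definition qw_fun r (k : 'I_(s * mdim n r)) (x : K) : hermspace h :=
  odot (qpoly k (set_val x)) (wpow r x).

Lemma qw_continuous r (k : 'I_(s * mdim n r)) : continuous (qw_fun k).
Proof.
apply: continuous_big; first exact: add_continuous.
move=> i _ x.
apply: (@continuousZ R[i] (hermspace h) K
  (fun y => coord u i (qpoly k (set_val y)) * coord u i (wpow r y))
  (cst (tnth u i))); last exact: cst_continuous.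
rewrite /qpoly; case: (enum_val _) => l j /=.
rewrite (_ : (fun _ => _) = (fun y : K => monom j (set_val y) *
    coord u i (tnth u l) *
    \sum_(m < s) (w m y ^+ r)%:C * coord u i (tnth u m))); last first.
  apply/funext => y; rewrite linearZ linear_sum; congr (_ * _).
  by apply: eq_bigr => m _; rewrite linearZ.
apply: continuousM; [apply: continuousM|].
- rewrite /monom; apply: continuous_big => //; first exact: mul_continuous.
  move=> m _; apply: continuous_exp => y.
  apply: (@continuous_comp _ _ _ set_val (fun z : 'rV[R[i]]_n => z 0 m)).
    exact: initial_continuous.
  exact: coord_continuous.
- exact: cst_continuous.
- apply: continuous_big => //; first exact: add_continuous.
  move=> m _ y.
  apply: (@continuousM R[i] K (fun y => (w m y ^+ r)%:C)
    (cst (coord u i (tnth u m)))); last exact: cst_continuous.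
  apply: (@continuous_comp _ _ _ (fun y => w m y ^+ r) (real_complex R)).
    by apply: continuous_exp; exact: cts_fun.
  exact: real_complex_continuous.
Qed.

Definition qw r (k : 'I_(s * mdim n r)) : continuousType K (hermspace h) :=
  mkcts (@qw_continuous r k).

(* The maximum over the unit spheres of the dual is attained (weak-* compactness
   of the unit ball and multilinearity), hence equal to this supremum. *)
Definition weighted_diam (r : nat) : R :=
  sup [set rnorm (\det (\matrix_(i, j) T i (qw j)))
      | T in [set T : 'I_(s * mdim n r) ->
                      {scalar continuousType K (hermspace h)}
             | forall i, bounded_functional (T i) /\ opnorm (T i) = 1]]
  `^ (s * ell n r)%:R^-1.

End WeightedDiameter.

(* Main.v *)
Require Import Defs.
From HB Require Import structures.
From mathcomp Require Import all_boot all_order all_algebra all_fingroup.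
From mathcomp Require Import all_classical all_reals all_analysis.
From mathcomp Require Import complex.
From mathcomp Require Import zify ring lra.

(* Multiplying polynomials of degree at most [r] by [w ^ r] turns them into the
   homogeneous polynomials of degree [r] in the [n + 1] functions [w] and
   [w x_i] on [K].  For an exponent [a] let [cheb a] be the least sup norm on [K]
   of a homogeneous polynomial with lexicographic leading monomial [z ^ a].
   Expanding determinants, both the weighted Vandermonde maximum and the maximum
   over functionals lie between the product [P r] of the Chebyshev constants of
   degree [r] (for the functionals, of all the weights) and a factorial multiple
   of it, and the factorial disappears after taking [ell]-th roots.
   Convergence of [P r ^ (1 / ell r)]: [ln cheb] is subadditive in [a], and its
   mean over the exponents of degree [r] is then subadditive in [r], because
   Polya's urn splits a uniformly random exponent of degree [d + e] into uniformly
   random exponents of degrees [d] and [e]; Fekete's lemma concludes. *)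

Set Implicit Arguments.
Unset Strict Implicit.
Unset Printing Implicit Defensive.

Import Order.TTheory GRing.Theory Num.Def Num.Theory numFieldNormedType.Exports.
Local Open Scope classical_set_scope.
Local Open Scope ring_scope.
Local Open Scope complex_scope.

(** * Polya's urn on exponents *)

Section Compositions.
Local Open Scope nat_scope.

(** Plain lists keep the recursion on the number of variables free of dependent types. *)
Fixpoint comps (k d : nat) : seq (seq nat) :=
  if k is k'.+1
  then flatten [seq [seq i :: t | t <- comps k' (d - i)] | i <- iota 0 d.+1]
  else if d is 0 then [:: [::]] else [::].

Definition addseq (a b : seq nat) : seq nat := [seq p.1 + p.2 | p <- zip a b].

(** The number of ways to draw [a] from an urn with [a_i + b_i] balls of colour [i]. *)
Definition urn_weight (a b : seq nat) : nat :=
  \prod_(p <- zip a b) 'C(p.1 + p.2, p.1).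

Lemma mem_comps k d a : (a \in comps k d) = (size a == k) && (sumn a == d).
Proof.
elim: k d a => [|k IHk] d a; first by case: d a => [|d] [|x a].
apply/flatten_mapP/idP => [[x]|].
  rewrite mem_iota add0n ltnS /= => le_xd /mapP[t].
  by rewrite IHk => /andP[/eqP<- /eqP st] ->; rewrite /= eqxx st subnKC /=.
case: a => [|x a] // /andP[sa /eqP<-].
exists x; first by rewrite mem_iota /= add0n ltnS leq_addr.
by apply/mapP; exists a; rewrite // IHk -eqSS sa addKn eqxx.
Qed.

Lemma uniq_comps k d : uniq (comps k d).
Proof.
elim: k d => [|k IHk] d; first by case: d.
apply: allpairs_uniq_dep; rewrite ?iota_uniq //.
by move=> [i t] [j t'] /= _ _ [-> ->].
Qed.

Lemma size_addseq a b : size a = size b -> size (addseq a b) = size a.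
Proof. by move=> e; rewrite size_map size_zip e minnn. Qed.

Lemma sumn_addseq a b : size a = size b -> sumn (addseq a b) = sumn a + sumn b.
Proof.
elim: a b => [|x a IH] [|y b] //= [e].
by rewrite -/(addseq a b) (IH b e); lia.
Qed.

Lemma mem_addseq k d e a b : a \in comps k d -> b \in comps k e ->
  addseq a b \in comps k (d + e).
Proof.
rewrite !mem_comps => /andP[/eqP sa /eqP ta] /andP[/eqP sb /eqP tb].
by rewrite size_addseq ?sumn_addseq ?sa ?sb ?ta ?tb // !eqxx.
Qed.

Lemma addseqC a b : addseq a b = addseq b a.
Proof.
elim: a b => [|x a IH] [|y b] //; rewrite /addseq /= addnC; congr cons.
exact: IH.
Qed.

Lemma urn_weightC a b : urn_weight a b = urn_weight b a.
Proof.
elim: a b => [|x a IH] [|y b]; rewrite /urn_weight /= ?big_nil // !big_cons /=.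
by rewrite -/(urn_weight _ _) IH -bin_sub ?leq_addr // addKn addnC.
Qed.

Lemma big_comps (V : Type) (idx : V) (op : Monoid.law idx) k d
    (F : seq nat -> V) :
  \big[op/idx]_(a <- comps k.+1 d) F a =
  \big[op/idx]_(i < d.+1) \big[op/idx]_(t <- comps k (d - i))
    F (nat_of_ord i :: t).
Proof.
rewrite big_flatten big_map -[iota _ _]/(index_iota 0 d.+1) big_mkord.
by apply: eq_bigr => i _; rewrite big_map.
Qed.

(** Coefficient of [t^e] in [(1-t)^-(x+1) (1-t)^-(y+1) = (1-t)^-(x+y+2)], obtained here from
    Pascal's rule. *)
Lemma sum_bin_bin x y e :
  \sum_(i < e.+1) 'C(x + i, i) * 'C(y + (e - i), e - i) = 'C((x + y).+1 + e, e).
Proof.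
elim: y e => [|y IHy] e.
  rewrite addn0; under eq_bigr do rewrite add0n binn muln1.
  elim: e => [|e IHe]; first by rewrite big_ord1 !bin0.
  by rewrite big_ord_recr /= IHe addnC !addnS binS !addSn.
elim: e => [|e IHe]; first by rewrite big_ord1 !bin0.
rewrite (addnS _.+1 e) binS -IHe.
rewrite (_ : (x + y.+1).+1 + e = (x + y).+1 + e.+1); last lia.
rewrite -IHy !(big_ord_recr e.+1) /= subnn !bin0 [RHS]addnAC -big_split /=.
congr (_ + _); apply: eq_bigr => i _; rewrite -mulnDr; congr (_ * _).
have ie : i <= e by rewrite -ltnS.
rewrite (subSn ie); move: (e - i) => m.
by rewrite [in LHS]addSn binS addSnnS.
Qed.

(** Iterates [sum_bin_bin] over the entries of [a]. The value depends on [a] only through its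
    degree, which is why the marginals of the urn are uniform. *)
Lemma sum_urn_weight k a e : size a = k.+1 ->
  \sum_(b <- comps k.+1 e) urn_weight a b = 'C(sumn a + k + e, e).
Proof.
elim: k a e => [|k IHk] [|x a] // e.
  case: a => // _; rewrite big_comps big_ord_recr /= subnn.
  rewrite big1 ?add0r; last first.
    move=> i _; rewrite (_ : e - i = (e - i).-1.+1) ?big_nil //; have := ltn_ord i; lia.
  by rewrite big_seq1 /urn_weight big_seq1 /= !addn0 -bin_sub ?leq_addr // addKn.
move=> [sa]; rewrite big_comps.
rewrite (_ : x + sumn a + k.+1 = (x + (sumn a + k)).+1) -?sum_bin_bin; last lia.
apply: eq_bigr => i _; rewrite -(IHk a _ sa) big_distrr /=; apply: eq_bigr => b _.
by rewrite {1}/urn_weight /= big_cons /= -bin_sub ?leq_addr // addKn.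
Qed.

(** For [a = 0] every weight is 1, so that [sum_urn_weight] counts. *)
Lemma size_comps k d : size (comps k.+1 d) = 'C(d + k, k).
Proof.
have urn0 m b : urn_weight (nseq m 0) b = 1.
  elim: m b => [|m IHm] [|y b]; rewrite /urn_weight /= ?big_nil // big_cons bin0.
  by rewrite mul1n; exact: IHm.
have := sum_urn_weight d (size_nseq k.+1 0).
rewrite sumn_nseq mul0n add0n -sum1_size addnC -[in RHS]bin_sub ?leq_addr // addKn => <-.
by apply: eq_bigr => b _; rewrite urn0.
Qed.

End Compositions.

Arguments comps : simpl never.

(** By Vandermonde's identity the splittings of a fixed [c] of degree [d + e] have total weight
    ['C(d + e, d)]. *)
Lemma sum_urn_addseq (V : zmodType) k d e (F : seq nat -> V) :
  \sum_(a <- comps k d) \sum_(b <- comps k e) F (addseq a b) *+ urn_weight a b =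
  (\sum_(c <- comps k (d + e)) F c) *+ 'C(d + e, d).
Proof.
elim: k d e F => [|k IHk] d e F.
  case: d => [|d]; last by rewrite !big_nil mul0rn.
  case: e => [|e]; last by rewrite big_seq1 !big_nil mul0rn.
  by rewrite !big_seq1 /urn_weight big_nil.
pose G s := \sum_(c <- comps k (d + e - s)) F (s :: c).
(* With the first entries [i] and [j] fixed, the induction hypothesis applies to the tails. *)
transitivity (\sum_(i < d.+1) \sum_(j < e.+1)
    G (i + j)%N *+ ('C(d + e - (i + j), d - i) * 'C(i + j, i))).
  rewrite big_comps; apply: eq_bigr => i _.
  under eq_bigr do rewrite big_comps.
  rewrite exchange_big /=; apply: eq_bigr => j _.
  rewrite mulrnA /G.
  have := ltn_ord i; have := ltn_ord j; rewrite !ltnS => je id.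
  rewrite (_ : d + e - (i + j) = (d - i) + (e - j))%N; last by lia.
  rewrite -IHk -sumrMnl; apply: eq_bigr => a _; rewrite -sumrMnl.
  by apply: eq_bigr => b _; rewrite -mulrnA {1}/urn_weight /= big_cons mulnC.
(* Substitution [s = i + j]; the values of [s] added to the range carry a vanishing binomial
   coefficient. *)
transitivity (\sum_(i < d.+1) \sum_(0 <= s < (d + e).+1)
    G s *+ ('C(d + e - s, d - i) * 'C(s, i))).
  apply: eq_bigr => i _; have := ltn_ord i; rewrite ltnS => id.
  rewrite [RHS](big_cat_nat (n := i)) //; last by lia.
  rewrite [X in _ = X + _]big_nat_cond [X in _ = X + _]big1 ?add0r; last first.
    by move=> s si; rewrite (@bin_small s) ?muln0 //; lia.
  rewrite [RHS](big_cat_nat (n := (i + e.+1)%N)); [|by lia|by lia].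
  rewrite [X in _ = _ + X]big_nat_cond [X in _ = _ + X]big1 ?addr0; last first.
    by move=> s si; rewrite (@bin_small (d + e - s)) ?mul0n //; lia.
  rewrite -[X in _ = \sum_(X <= _ < _) _]add0n big_addn addKn big_mkord.
  by apply: eq_bigr => j _; rewrite addnC.
rewrite exchange_big /= big_comps -sumrMnl big_mkord.
apply: eq_bigr => s _; rewrite sumrMnr; congr (_ *+ _).
have le_s : (s <= d + e)%N by rewrite -ltnS ltn_ord.
have := binomial.Vandermonde s (d + e - s)%N d; rewrite (subnKC le_s) => <-.
by apply: eq_bigr => i _; rewrite mulnC.
Qed.

(** * Subadditive sequences *)

Section Fekete.
Variable R : realType.

Lemma cvg_divn (C : R) : C / d%:R @[d --> \oo] --> 0.
Proof.
rewrite -(mulr0 C); apply: cvgMr.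
apply/cvgrPdist_lt => e e0; near=> d.
have d0 : 0 < d%:R :> R by rewrite ltr0n; near: d; exists 1%N.
rewrite sub0r normrN ger0_norm ?invr_ge0 ?ltW // invf_plt //.
by near: d; exact: nbhs_infty_gtr.
Unshelve. all: by end_near. Qed.

(* [expR] turns the possible limit [-oo] into the limit [0]. *)
Lemma fekete_expR (a : nat -> R) :
  (forall d e, a (d + e)%N <= a d + a e) -> cvgn (fun d => expR (a d / d%:R)).
Proof.
move=> suba; set E := [set expR (a d / d%:R) | d in [set d | (0 < d)%N]].
have E0 : E !=set0 by exists (expR (a 1 / 1%:R)); exists 1%N.
have lbE : has_lbound E by exists 0 => _ [d _ <-]; exact: expR_ge0.
apply/cvg_ex; exists (inf E); apply/cvgrPdist_lt => eps eps0.
have [_ [e e0 <-] ltE] := inf_adherent eps0 (conj E0 lbE).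
(* For [d = q e + r], subadditivity gives [a d <= q a(e) + r |a(1)| + a(0)]; [C] absorbs [r < e] and
   the change from [q] to [d / e]. *)
pose C := `|a e| + e%:R * `|a 1| + a 0.
have Cd d : a d <= d%:R / e%:R * a e + C.
  have mul_le q r : a (q * e + r)%N <= a e *+ q + `|a 1| *+ r + a 0.
    elim: q => [|q IHq].
      rewrite mul0n mulr0n add0n add0r; elim: r => [|r IHr]; first by rewrite add0r.
      rewrite mulrSr -[in leLHS]addn1; apply: (le_trans (suba _ _)).
      by rewrite addrAC; apply: lerD; rewrite ?ler_norm.
    rewrite mulSn -addnA mulrS -!addrA; apply: (le_trans (suba _ _)).
    by rewrite lerD2l addrA.
  have e0' : 0 < e%:R :> R by rewrite ltr0n.
  have lt_mod : (d %% e)%:R <= e%:R :> R by rewrite ler_nat ltnW ?ltn_mod.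
  rewrite {1}(divn_eq d e); apply: (le_trans (mul_le _ _)).
  have -> : d%:R / e%:R * a e = a e *+ (d %/ e) + (d %% e)%:R / e%:R * a e.
    rewrite [in LHS](divn_eq d e) natrD natrM -mulr_natr; field.
    by rewrite gt_eqF.
  rewrite /C -!addrA lerD2l addrA addrA lerD2r -mulr_natr mulrC -lerBlDr.
  have : (d %% e)%:R / e%:R * - a e <= `|a e|.
    apply: (@le_trans _ _ ((d %% e)%:R / e%:R * `|a e|)).
      by rewrite ler_wpM2l ?divr_ge0 // -normrN ler_norm.
    by rewrite ler_piMl // ler_pdivrMr // mul1r.
  have : (d %% e)%:R * `|a 1| <= e%:R * `|a 1| by rewrite ler_wpM2r.
  lra.
have cvgC : expR (a e / e%:R) * expR (C / d%:R) @[d --> \oo] -->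
    expR (a e / e%:R).
  rewrite -[X in _ --> X]mulr1; apply: cvgMr; rewrite -[X in _ --> X]expR0.
  apply: (continuous_cvg _ (@continuous_expR R 0)); exact: cvg_divn.
near=> d.
have d0 : (0 < d)%N by near: d; exists 1%N.
have le_inf : inf E <= expR (a d / d%:R) by apply: ge_inf => //; exists d.
rewrite distrC ger0_norm ?subr_ge0 // ltrBlDl.
apply: (@le_lt_trans _ _ (expR (a e / e%:R) * expR (C / d%:R))).
  rewrite -expRD ler_expR ler_pdivrMr ?ltr0n // mulrDl.
  rewrite divfK ?pnatr_eq0 -?lt0n // (le_trans (Cd d)) // lerD2r.
  by rewrite mulrC mulrA mulrAC.
by near: d; apply: (cvgr_lt _ cvgC).
Unshelve. all: by end_near. Qed.

End Fekete.

(** * Subadditivity of the mean over the exponents of a given degree *)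

Section UrnMean.
Variables (R : realType) (n : nat) (f : seq nat -> R).
Hypothesis f_sub : forall d e a b, a \in comps n.+1 d -> b \in comps n.+1 e ->
  f (addseq a b) <= f a + f b.

Definition comps_mean (d : nat) : R :=
  (\sum_(a <- comps n.+1 d) f a) / 'C(d + n, n)%:R.

(* A uniformly random [c] of degree [d + e], split by drawing [d] balls without
   replacement from an urn with [c_i] balls of colour [i], yields marginals that
   are uniform in degrees [d] and [e] (Polya's urn). *)
Lemma comps_mean_sub d e : comps_mean (d + e) <= comps_mean d + comps_mean e.
Proof.
have := sum_urn_addseq n.+1 d e f; set S := \sum_(c <- comps _ (d + e)) f c.
pose M a' e' := ('C(a' + n + e', e'))%:R : R.
move=> urn.
have le1 : S *+ 'C(d + e, d) <=
    (\sum_(a <- comps n.+1 d) f a) * M d e + (\sum_(b <- comps n.+1 e) f b) * M e d.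
  rewrite -urn; apply: (@le_trans _ _ (\sum_(a <- comps n.+1 d)
      \sum_(b <- comps n.+1 e) (f a + f b) *+ urn_weight a b)).
    rewrite big_seq [leRHS]big_seq; apply: ler_sum => a ha.
    rewrite big_seq [leRHS]big_seq; apply: ler_sum => b hb.
    by rewrite lerMn2r (f_sub ha hb) orbT.
  rewrite le_eqVlt; apply/orP; left; apply/eqP.
  under eq_bigr do [under eq_bigr do rewrite mulrnDl; rewrite big_split].
  rewrite big_split /=; congr (_ + _); last rewrite exchange_big /=.
    rewrite mulr_suml [LHS]big_seq [RHS]big_seq; apply: eq_bigr => a.
    rewrite mem_comps => /andP[/eqP sa /eqP ta].
    by rewrite sumrMnr sum_urn_weight // ta mulr_natr.
  rewrite mulr_suml [LHS]big_seq [RHS]big_seq; apply: eq_bigr => b.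
  rewrite mem_comps => /andP[/eqP sb /eqP tb].
  under eq_bigr do rewrite urn_weightC.
  by rewrite sumrMnr sum_urn_weight // tb mulr_natr.
(* Cross-multiplied, both sides are the trinomial coefficient [(d' + e' + n)! / (d'! e'! n!)]; the
   factorials are cleared in [nat]. *)
have binE d' e' : (M d' e' : R) =
    'C(d' + e', d')%:R * 'C(d' + e' + n, n)%:R / 'C(d' + n, n)%:R.
  apply: (canRL (mulfK _)); first by rewrite pnatr_eq0 -lt0n bin_gt0 leq_addl.
  rewrite /M -!natrM; congr _%:R.
  have key p q : ('C(p + q, p) * (p`! * q`!) = (p + q)`!)%N.
    by have := bin_fact (leq_addr q p); rewrite addKn.
  have F0 p : (0 < p`!)%N := fact_gt0 p.
  apply/eqP; rewrite -(eqn_pmul2r (F0 e')) -(eqn_pmul2r (F0 n)).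
  rewrite -(eqn_pmul2r (F0 d')) -(eqn_pmul2r (F0 (d' + n)%N)).
  rewrite -(eqn_pmul2r (F0 (d' + e')%N)).
  have k1 := key e' (d' + n)%N; have k2 := key n d'; have k3 := key d' e'.
  have k4 := key n (d' + e')%N.
  rewrite [(e' + _)%N]addnC in k1; rewrite [(n + _)%N]addnC in k2.
  rewrite [(n + _)%N]addnC in k4.
  rewrite (_ : d' + e' + n = d' + n + e')%N in k4 *; last lia.
  apply/eqP; transitivity ((d' + n + e')`! * (d' + n)`! * (d' + e')`!)%N.
    by rewrite -k1 -{2}k2; ring.
  by rewrite -k4 -{1}k3; ring.
rewrite -mulr_natr in le1; rewrite /comps_mean -/S.
have C0 p q : 0 < ('C(p + q, q)%:R : R) by rewrite ltr0n bin_gt0 leq_addl.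
rewrite !binE [(e + d)%N]addnC in le1.
rewrite (_ : 'C(d + e, e) = 'C(d + e, d)) in le1; last first.
  by rewrite -bin_sub ?leq_addl // addnK.
have c0 : 0 < ('C(d + e, d)%:R : R) by rewrite ltr0n bin_gt0 leq_addr.
rewrite ler_pdivrMr // -(ler_pM2r c0); apply: (le_trans le1).
by rewrite le_eqVlt; apply/orP; left; apply/eqP; field; rewrite !gt_eqF.
Qed.

End UrnMean.

(** * Determinants and Chebyshev approximations *)

Section RealNorm.
Variable R : realType.
Implicit Types (V : normedZmodType R[i]) (y z : R[i]).

Lemma rnormE V (v : V) : (rnorm v)%:C = `|v|.
Proof. by rewrite /rnorm; apply/RRe_real/normr_real. Qed.

Lemma rnorm_ge0 V (v : V) : 0 <= rnorm v.
Proof. by rewrite -lecR rnormE; exact: normr_ge0. Qed.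

Lemma rnorm0 V : rnorm (0 : V) = 0.
Proof. by rewrite /rnorm normr0. Qed.

Lemma rnormN V (v : V) : rnorm (- v) = rnorm v.
Proof. by rewrite /rnorm normrN. Qed.

Lemma rnormD V (v w : V) : rnorm (v + w) <= rnorm v + rnorm w.
Proof. by rewrite -lecR rmorphD /= !rnormE ler_normD. Qed.

Lemma rnorm_sum V I (r : seq I) (P : pred I) (F : I -> V) :
  rnorm (\sum_(i <- r | P i) F i) <= \sum_(i <- r | P i) rnorm (F i).
Proof.
elim/big_rec2: _ => [|i x y _ le_xy]; first by rewrite rnorm0.
by rewrite (le_trans (rnormD _ _)) // lerD2l.
Qed.

Lemma rnormM y z : rnorm (y * z) = rnorm y * rnorm z.
Proof. by apply: complexI; rewrite rmorphM /= !rnormE normrM. Qed.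

Lemma rnorm1 : rnorm (1 : R[i]) = 1.
Proof. by rewrite /rnorm normr1. Qed.

Lemma rnorm_prod I (r : seq I) (P : pred I) (F : I -> R[i]) :
  rnorm (\prod_(i <- r | P i) F i) = \prod_(i <- r | P i) rnorm (F i).
Proof. exact: (big_morph _ rnormM rnorm1). Qed.

Lemma rnormX z m : rnorm (z ^+ m) = rnorm z ^+ m.
Proof. by elim: m => [|m IHm]; rewrite ?rnorm1 // !exprS rnormM IHm. Qed.

Lemma rnorm_real (x : R) : 0 <= x -> rnorm x%:C = x.
Proof. by move=> x0; rewrite /rnorm ger0_norm // lecR. Qed.

Lemma rnorm_sign (b : nat) : rnorm ((-1) ^+ b : R[i]) = 1.
Proof. by rewrite rnormX rnormN rnorm1 expr1n. Qed.

Lemma rnormZ (V : normedModType R[i]) z (v : V) : rnorm (z *: v) = rnorm z * rnorm v.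
Proof. by apply: complexI; rewrite rmorphM /= !rnormE normrZ. Qed.

End RealNorm.

(** * Bounds for determinants by best approximation *)

Section Determinants.

(** A permutation other than the identity sends the moved index of maximal key to another moved
    index, hence to a key no larger, and that entry vanishes. Keys avoid sorting the indices. *)
Lemma det_unitriangular (F : comNzRingType) d (T : orderType d) N
    (key : 'I_N -> T) (B : 'M[F]_N) :
  (forall i, B i i = 1) ->
  (forall i j, i != j -> ~~ (key i < key j)%O -> B i j = 0) -> \det B = 1.
Proof.
move=> B1 B0; rewrite /determinant (bigD1 1%g) //= odd_perm1 expr0 mul1r.
rewrite big1 => [|i _]; last by rewrite perm1 B1.
rewrite big1 ?addr0 // => g /eqP g_neq1.
have [i0 gi0] : exists i, g i != i.
  apply/existsP; apply: contra_notT g_neq1 => /existsPn g1.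
  by apply/perm.permP => i; rewrite perm1; exact/eqP/negPn/g1.
have [i gi max_i] :=
  @Order.TotalTheory.arg_maxP _ _ _ i0 (fun i => g i != i) key gi0.
rewrite (bigD1 i) //= B0 ?mul0r ?mulr0 1?eq_sym // -leNgt.
by apply: max_i; rewrite /= inj_eq //; exact: perm_inj.
Qed.

Variable R : realType.

Lemma rnorm_det_le N (M : 'M[R[i]]_N) (c : 'I_N -> R) :
  (forall i j, rnorm (M i j) <= c j) ->
  rnorm (\det M) <= N`!%:R * \prod_j c j.
Proof.
move=> Mc; apply: (le_trans (rnorm_sum _ _ _)).
rewrite -card_Sn mulr_natl -sumr_const [leRHS](eq_bigl xpredT) //.
apply: ler_sum => g _; rewrite rnormM rnorm_sign mul1r rnorm_prod.
rewrite [leRHS](reindex_inj (@perm_inj _ g)) /=.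
by apply: ler_prod => i _; rewrite rnorm_ge0 Mc.
Qed.

(** Infima are not assumed attained; the slack [e] is removed by letting it tend to 0 from the
    right. *)
Lemma ler_prod_approx N (x C : R) (t : 'I_N -> R) :
  (forall e, 0 < e -> x <= C * \prod_j (t j + e)) -> x <= C * \prod_j t j.
Proof.
move=> le_x; pose f (e : R) := C * \prod_j (t j + e).
have cf : continuous f.
  move=> e; apply: cvgMr; apply: continuous_big => // [|i _]; first exact: mul_continuous.
  by move=> y; apply: cvgD; [exact: cvg_cst|exact: cvg_id].
have cvgf : f e @[e --> 0^'+] --> f 0 by apply: cvg_at_right_filter; exact: cf.
rewrite (_ : _ * _ = f 0); last by congr (_ * _); apply: eq_bigr => i _; rewrite addr0.
apply: (cvgr_to_ge cvgf); near=> e; apply: le_x; near: e; exact: nbhs_right_gt.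
Unshelve. all: by end_near. Qed.

(** A zero factor is treated apart, since no nonnegative number lies strictly below it. *)
Lemma prodr_ge_approx N (x : R) (t : 'I_N -> R) : 0 <= x -> (forall j, 0 <= t j) ->
  (forall c : 'I_N -> R, (forall j, 0 <= c j) -> (forall j, c j < t j) ->
    \prod_j c j <= x) -> \prod_j t j <= x.
Proof.
move=> x0 t0 le_x; have [/existsP[j /eqP tj0]|] := boolP [exists j, t j == 0].
  by rewrite (bigD1 j) //= tj0 mul0r.
move=> /existsPn tN0; have {}tN0 j : 0 < t j by rewrite lt_neqAle eq_sym tN0 t0.
(* The choice [c j = (1 - e) t j], with [e] tending to 0. *)
pose f (e : R) := (1 - e) ^+ N * \prod_j t j.
have cf : continuous f.
  move=> e; apply: cvgM; last exact: cvg_cst.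
  apply: (continuous_comp (f := fun e : R => 1 - e) (g := fun y => y ^+ N)).
    by apply: cvgB; [exact: cvg_cst|exact: cvg_id].
  exact: exprn_continuous.
have cvgf : f e @[e --> 0^'+] --> f 0 by apply: cvg_at_right_filter; exact: cf.
rewrite (_ : \prod_j t j = f 0); last by rewrite /f subr0 expr1n mul1r.
apply: (cvgr_to_le cvgf); near=> e.
have e0 : 0 < e by near: e; exact: nbhs_right_gt.
have e1 : e < 1 by near: e; exact: nbhs_right_lt.
rewrite /f -[X in _ ^+ X]card_ord -prodr_const -big_split /=.
apply: le_x => j; first by rewrite mulr_ge0 // subr_ge0 ltW.
by rewrite gtr_pMl // ltrBlDr ltrDl.
Unshelve. all: by end_near. Qed.

(** Adding to each column a combination of columns of smaller key preserves the determinant and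
    brings the entries of column [j] below [t j + e]; the Leibniz formula concludes. *)
Lemma det_le_chebyshev d (T : orderType d) N (key : 'I_N -> T) (M : 'M[R[i]]_N)
    (t : 'I_N -> R) :
  (forall e, 0 < e -> forall j, exists b : 'I_N -> R[i], forall k,
     rnorm (M k j + \sum_(i | (key i < key j)%O) b i * M k i) <= t j + e) ->
  rnorm (\det M) <= N`!%:R * \prod_j t j.
Proof.
move=> cheb; apply: ler_prod_approx => e e0.
have [b hb] := choice (cheb e e0).
pose B := \matrix_(i, j) (if i == j then 1 else if (key i < key j)%O then b j i else 0).
have <- : \det (M *m B) = \det M.
  rewrite det_mulmx (@det_unitriangular _ _ _ _ key B) ?mulr1 // => [i|i j ij].
    by rewrite mxE eqxx.
  by move=> /negPf kij; rewrite mxE (negPf ij) kij.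
apply: rnorm_det_le => k j; apply: le_trans (hb j k); rewrite le_eqVlt.
apply/orP; left; apply/eqP; congr rnorm.
rewrite mxE (bigD1 j) //= mxE eqxx mulr1; congr (_ + _).
rewrite big_mkcond [RHS]big_mkcond; apply: eq_bigr => i _.
rewrite mxE; have [->|ij] := eqVneq i j; first by rewrite ltxx.
by case: ifP => _; rewrite ?mulr0 // mulrC.
Qed.

(** Induction on [N]: points for all functions but the one of largest key come first. Expanding
    along the row of a further point [y] leaves a cofactor times this function plus lower terms at
    [y], and the hypothesis supplies [y]. *)
Lemma det_ge_chebyshev d (T : orderType d) (X : Type) N (key : 'I_N -> T)
    (phi : 'I_N -> X -> R[i]) (c : 'I_N -> R) :
  injective key -> (forall j, 0 <= c j) ->
  (forall j (b : 'I_N -> R[i]), exists x,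
     c j <= rnorm (phi j x + \sum_(i | (key i < key j)%O) b i * phi i x)) ->
  exists x : 'I_N -> X,
    \prod_j c j <= rnorm (\det (\matrix_(i, j) phi j (x i))).
Proof.
elim: N key phi c => [|N IHN] key phi c key_inj c0 cheb.
  have x : 'I_0 -> X by case.
  by exists x; rewrite big_ord0 det_mx00 rnorm1.
have [j0 _ max_j0] :=
  @Order.TotalTheory.arg_maxP _ _ _ (@ord0 N) xpredT key isT.
have {}max_j0 j : (key j <= key j0)%O := max_j0 j isT.
have lt_j0 j : (key j < key j0)%O = (j != j0).
  by rewrite lt_neqAle max_j0 andbT (inj_eq key_inj).
have [|||x' hx'] := IHN (key \o lift j0) (fun j => phi (lift j0 j)) (c \o lift j0).
- exact: inj_comp key_inj (@lift_inj _ _).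
- by move=> j; exact: c0.
- move=> j b; have [x hx] := cheb (lift j0 j) (fun i => oapp b 0 (unlift j0 i)).
  exists x; apply: le_trans hx _; rewrite le_eqVlt; apply/orP; left.
  apply/eqP; congr (rnorm (_ + _)).
  rewrite big_mkcond (bigD1_ord j0) //= ltNge max_j0 // add0r -big_mkcond.
  by apply: eq_bigr => i _; rewrite liftK.
set D := \det _ in hx'.
(* If the minor vanishes, so does the bound, and any point will do; [cheb] is called only to produce
   one. *)
have [D0|D0] := eqVneq D 0.
  have [y _] := cheb j0 (fun=> 0).
  exists (fun=> y); rewrite (bigD1_ord j0) //=.
  apply: (@le_trans _ _ (c j0 * 0)); last by rewrite mulr0 rnorm_ge0.
  by rewrite ler_wpM2l // (le_trans hx') // D0 rnorm0.
pose A y := \matrix_(i < N.+1, j < N.+1) phi j (if unlift ord0 i is Some k then x' k else y).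
pose cof (j : 'I_N.+1) : R[i] :=
  (-1) ^+ (@ord0 N + j) * \det (\matrix_(i < N, k < N) phi (lift j k) (x' i)).
have cofE y j : cofactor (A y) ord0 j = cof j.
  rewrite /cofactor /cof; congr (_ * \det _); apply/matrixP => i k.
  by rewrite !mxE liftK.
have cof0 : cof j0 != 0 by rewrite mulf_neq0 // signr_eq0.
(* Division by the cofactor of [j0] gives [phi j0] the coefficient 1. *)
have [y hy] := cheb j0 (fun j => cof j / cof j0).
exists (fun i => if unlift ord0 i is Some k then x' k else y).
rewrite -/(A y) (expand_det_row _ ord0).
have -> : \sum_j A y ord0 j * cofactor (A y) ord0 j =
    cof j0 * (phi j0 y + \sum_(i | (key i < key j0)%O) cof i / cof j0 * phi i y).
  rewrite (bigD1 j0) //= cofE mxE unlift_none mulrDr [phi _ _ * _]mulrC.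
  congr (_ + _); rewrite mulr_sumr; apply: eq_big => [j|j _]; first by rewrite lt_j0.
  by rewrite cofE mxE unlift_none; field.
rewrite (bigD1_ord j0) //= rnormM mulrC.
by apply: ler_pM => //; [exact: prodr_ge0|rewrite rnormM rnorm_sign mul1r].
Qed.

End Determinants.

(** * Chebyshev constants of homogeneous polynomials *)

Definition lexlt (a b : seq nat) : bool := ((a : seqlexi nat) < b)%O.

Lemma lexlt_cons x y a b : lexlt (x :: a) (y :: b) = (x < y)%N || (x == y) && lexlt a b.
Proof.
rewrite /lexlt Order.SeqLexiOrder.Exports.ltxi_cons !leEnat implybE -ltnNge.
by case: ltngtP => //=.
Qed.

(** Translation invariance of the order makes leading monomials multiplicative. *)
Lemma lexlt_add2l a b b' : size a = size b -> size b = size b' ->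
  lexlt b b' -> lexlt (addseq a b) (addseq a b').
Proof.
elim: a b b' => [|x a IHa] [|y b] [|y' b'] // [ab] [bb'].
rewrite !lexlt_cons ltn_add2l eqn_add2l => /orP[->//|/andP[-> /=]].
by move=> /(IHa _ _ ab bb') ->; rewrite orbT.
Qed.

Lemma lexlt_add2r a b b' : size a = size b -> size b = size b' ->
  lexlt b b' -> lexlt (addseq b a) (addseq b' a).
Proof. by rewrite ![addseq _ a]addseqC; exact: lexlt_add2l. Qed.

(** * Sup norms of bounded functions *)

Section UniformNorm.
Variables (R : realType) (X : Type).
Implicit Types p q : X -> R[i].

Definition usup p : R := sup [set rnorm (p x) | x in [set: X]].

Definition ubounded p : Prop := exists M : R, forall x, rnorm (p x) <= M.

Lemma usup_ub p x : ubounded p -> rnorm (p x) <= usup p.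
Proof.
move=> [M pM]; apply: ub_le_sup; last by exists x.
by exists M => _ [y _ <-]; exact: pM.
Qed.

Lemma usup_ge0 p : 0 <= usup p.
Proof.
rewrite /usup; set E := (E in sup E).
(* [sup] is 0 on a set without supremum, which covers empty [X] and unbounded [p]. *)
have [[[y [x _ pxy]] ubE]|/sup_out ->//] := pselect (has_sup E).
apply: (@le_trans _ _ y); first by rewrite -pxy rnorm_ge0.
by apply: ub_le_sup => //; exists x.
Qed.

Lemma usup_le p M : 0 <= M -> (forall x, rnorm (p x) <= M) -> usup p <= M.
Proof.
move=> M0 pM; rewrite /usup; set E := (E in sup E).
have [->|/set0P E0] := eqVneq E set0; first by rewrite sup0.
by apply: ge_sup => // _ [x _ <-]; exact: pM.
Qed.

Lemma uboundedD p q : ubounded p -> ubounded q -> ubounded (fun x => p x + q x).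
Proof.
move=> [M pM] [L qL]; exists (M + L) => x.
by apply: (le_trans (rnormD _ _)); exact: lerD.
Qed.

Lemma uboundedM p q : ubounded p -> ubounded q -> ubounded (fun x => p x * q x).
Proof.
move=> [M pM] [L qL]; exists (M * L) => x.
by rewrite rnormM; apply: ler_pM; rewrite ?rnorm_ge0.
Qed.

Lemma ubounded_cst (z : R[i]) : ubounded (fun=> z).
Proof. by exists (rnorm z). Qed.

Lemma uboundedX p m : ubounded p -> ubounded (fun x => p x ^+ m).
Proof.
move=> bp; elim: m => [|m IHm]; first exact: ubounded_cst.
by under eq_fun do rewrite exprS; exact: uboundedM.
Qed.

Lemma ubounded_prod (I : Type) (r : seq I) (p : I -> X -> R[i]) :
  (forall i, ubounded (p i)) -> ubounded (fun x => \prod_(i <- r) p i x).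
Proof.
move=> bp; elim: r => [|i r IHr]; under eq_fun do rewrite ?big_nil ?big_cons.
  exact: ubounded_cst.
exact: uboundedM.
Qed.

Lemma ubounded_sum (I : Type) (r : seq I) (P : pred I) (p : I -> X -> R[i]) :
  (forall i, ubounded (p i)) -> ubounded (fun x => \sum_(i <- r | P i) p i x).
Proof.
move=> bp; elim: r => [|i r IHr]; under eq_fun do rewrite ?big_nil ?big_cons.
  exact: ubounded_cst.
by case: (P i) => //; exact: uboundedD.
Qed.

End UniformNorm.

(** * Submultiplicativity of the Chebyshev constants *)

Section Chebyshev.
Variables (R : realType) (X : Type) (k : nat) (z : 'I_k -> X -> R[i]).
Hypothesis z_bounded : forall i, ubounded (z i).
Implicit Types (a b c : seq nat) (p q : X -> R[i]).

Definition mon a (x : X) : R[i] := \prod_(i < k) z i x ^+ nth 0%N a i.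

Lemma mon_add a b x : size a = k -> size b = k ->
  mon (addseq a b) x = mon a x * mon b x.
Proof.
move=> sa sb; rewrite /mon -big_split /=; apply: eq_bigr => i _.
rewrite -exprD (nth_map (0, 0)%N) ?nth_zip ?sa ?sb //=.
by rewrite size_zip sa sb minnn.
Qed.

Lemma mon_bounded a : ubounded (mon a).
Proof. by apply: ubounded_prod => i; exact: uboundedX. Qed.

(** The order is put on exponents because distinct monomials may coincide as functions on [X]. *)
Definition lower a : set (X -> R[i]) :=
  [set q | exists g : seq nat -> R[i], forall x,
     q x = \sum_(c <- comps k (sumn a) | lexlt c a) g c * mon c x].

Definition cheb a : R :=
  inf [set usup (fun x => mon a x + q x) | q in lower a].

Lemma lower0 a : lower a (fun=> 0).
Proof. by exists (fun=> 0) => x; rewrite big1 // => c _; rewrite mul0r. Qed.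

Lemma lowerD a p q : lower a p -> lower a q -> lower a (fun x => p x + q x).
Proof.
move=> [g pg] [g' qg']; exists (fun c => g c + g' c) => x.
by rewrite pg qg' -big_split /=; apply: eq_bigr => c _; rewrite mulrDl.
Qed.

Lemma lowerZ a (l : R[i]) q : lower a q -> lower a (fun x => l * q x).
Proof.
move=> [g qg]; exists (fun c => l * g c) => x.
by rewrite qg mulr_sumr; apply: eq_bigr => c _; rewrite mulrA.
Qed.

Lemma lower_sum (I : eqType) a (r : seq I) (P : pred I) (p : I -> X -> R[i]) :
  (forall c : I, c \in r -> P c -> lower a (p c)) ->
  lower a (fun x => \sum_(c <- r | P c) p c x).
Proof.
elim: r => [|c r IHr] hp; under eq_fun do rewrite ?big_nil ?big_cons.
  exact: lower0.
have {}IHr : lower a (fun x => \sum_(j <- r | P j) p j x).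
  by apply: IHr => c' c'r; apply: hp; rewrite in_cons c'r orbT.
by case Pc: (P c) => //; apply: lowerD => //; apply: hp; rewrite ?mem_head.
Qed.

Lemma lower_mon a c : c \in comps k (sumn a) -> lexlt c a -> lower a (mon c).
Proof.
move=> hc ca; exists (fun c' => (c' == c)%:R) => x.
rewrite big_mkcond (bigD1_seq c) ?uniq_comps //= ca eqxx mul1r big1 ?addr0 //.
by move=> c' /negPf ->; rewrite mul0r if_same.
Qed.

Lemma lower_bounded a q : lower a q -> ubounded q.
Proof.
move=> [g qg]; rewrite (funext qg); apply: ubounded_sum => c.
by apply: uboundedM; [exact: ubounded_cst|exact: mon_bounded].
Qed.

Lemma cheb_ge0 a : 0 <= cheb a.
Proof.
apply: lb_le_inf => [|_ [q _ <-]]; last exact: usup_ge0.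
by eexists; exists (fun=> 0); [exact: lower0|].
Qed.

Lemma cheb_le a q : lower a q -> cheb a <= usup (fun x => mon a x + q x).
Proof.
by move=> aq; apply: ge_inf; [exists 0 => _ [p _ <-]; exact: usup_ge0|exists q].
Qed.

Lemma cheb_approx a e : 0 < e ->
  exists2 q, lower a q & forall x, rnorm (mon a x + q x) <= cheb a + e.
Proof.
have hinf : has_inf [set usup (fun x => mon a x + q x) | q in lower a].
  split; first by eexists; exists (fun=> 0); [exact: lower0|].
  by exists 0 => _ [p _ <-]; exact: usup_ge0.
move=> e0; have [_ [q aq <-] lt_e] := inf_adherent e0 hinf.
exists q => // x; apply: le_trans (ltW lt_e); apply: (@usup_ub _ _ (fun x => mon a x + q x)).
exact: uboundedD (mon_bounded a) (lower_bounded aq).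
Qed.

Lemma cheb_gt a q e : 0 <= e -> e < cheb a -> lower a q ->
  exists x, e <= rnorm (mon a x + q x).
Proof.
move=> e0 e_lt aq; apply: contrapT => /forallNP noX.
(* Nonnegativity of [e] covers empty [X], where [usup] is 0. *)
suff : cheb a <= e by rewrite leNgt e_lt.
apply: (le_trans (cheb_le aq)); apply: usup_le => // x.
by move: (noX x) => /negP; rewrite -ltNge => /ltW.
Qed.

(** Of the four products only [mon a * mon b] has exponent [a + b]; the others are combinations of
    smaller monomials by translation invariance. *)
Lemma lower_mul a b p q : size a = k -> size b = k -> lower a p -> lower b q ->
  exists2 r, lower (addseq a b) r &
    forall x, (mon a x + p x) * (mon b x + q x) = mon (addseq a b) x + r x.
Proof.
move=> sa sb ap bq; exists (fun x => mon a x * q x + (p x * mon b x + p x * q x)); last first.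
  by move=> x; rewrite mon_add //; ring.
have sab : size a = size b by rewrite sa sb.
have memab c c' : c \in comps k (sumn a) -> c' \in comps k (sumn b) ->
    addseq c c' \in comps k (sumn (addseq a b)).
  by rewrite sumn_addseq //; exact: mem_addseq.
have mema : a \in comps k (sumn a) by rewrite mem_comps sa !eqxx.
have memb : b \in comps k (sumn b) by rewrite mem_comps sb !eqxx.
have size_mem c d : c \in comps k d -> size c = k.
  by rewrite mem_comps => /andP[/eqP].
have low1 c' : c' \in comps k (sumn b) -> lexlt c' b ->
    lower (addseq a b) (fun x => mon a x * mon c' x).
  move=> c'b lt_c'; under eq_fun do rewrite -mon_add ?(size_mem _ _ c'b) //.
  apply: lower_mon; first exact: memab.
  by apply: lexlt_add2l; rewrite ?(size_mem _ _ c'b).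
have low2 c : c \in comps k (sumn a) -> lexlt c a ->
    lower (addseq a b) (fun x => mon c x * mon b x).
  move=> ca lt_c; under eq_fun do rewrite -mon_add ?(size_mem _ _ ca) //.
  apply: lower_mon; first exact: memab.
  by apply: lexlt_add2r; rewrite ?(size_mem _ _ ca).
have low3 c c' : c \in comps k (sumn a) -> lexlt c a ->
    c' \in comps k (sumn b) -> lexlt c' b ->
    lower (addseq a b) (fun x => mon c x * mon c' x).
  move=> ca lt_c c'b lt_c'.
  under eq_fun do rewrite -mon_add ?(size_mem _ _ ca) ?(size_mem _ _ c'b) //.
  apply: lower_mon; first exact: memab.
  have sc := size_mem _ _ ca; have sc' := size_mem _ _ c'b.
  (* The comparison passes through [c + b]: [c + c' < c + b < a + b]. *)
  apply: (@lt_trans _ _ (addseq c b : seqlexi nat)).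
    by apply: lexlt_add2l; rewrite ?sc ?sc'.
  by apply: lexlt_add2r; rewrite ?sc ?sc'.
have [g pg] := ap; have [g' qg'] := bq.
rewrite (funext pg) (funext qg'); apply: lowerD; last apply: lowerD.
- under eq_fun => x.
    rewrite mulr_sumr; under eq_bigr do rewrite mulrCA.
    over.
  by apply: lower_sum => c' c'b lt_c'; apply: lowerZ; exact: low1.
- under eq_fun => x.
    rewrite mulr_suml; under eq_bigr do rewrite -mulrA.
    over.
  by apply: lower_sum => c ca lt_c; apply: lowerZ; exact: low2.
- under eq_fun => x.
    rewrite mulr_suml; under eq_bigr do rewrite -mulrA.
    over.
  apply: lower_sum => c ca lt_c; apply: lowerZ.
  under eq_fun => x.
    rewrite mulr_sumr; under eq_bigr do rewrite mulrCA.
    over.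
  by apply: lower_sum => c' c'b lt_c'; apply: lowerZ; exact: low3.
Qed.

(** The product of two near-minimisers competes for [a + b]; [ler_prod_approx] with two factors
    removes the slack. *)
Lemma cheb_submul a b : size a = k -> size b = k ->
  cheb (addseq a b) <= cheb a * cheb b.
Proof.
move=> sa sb; pose t (i : 'I_2) := if i == ord0 then cheb a else cheb b.
have := @ler_prod_approx R 2 (cheb (addseq a b)) 1 t.
rewrite mul1r !big_ord_recl !big_ord0 /t /= mulr1; apply=> e e0.
rewrite mul1r !big_ord_recl !big_ord0 /= mulr1.
have [p ap hp] := cheb_approx a e0; have [q bq hq] := cheb_approx b e0.
have [r abr hr] := lower_mul sa sb ap bq.
apply: (le_trans (cheb_le abr)); apply: usup_le => [|x].
  by rewrite mulr_ge0 // addr_ge0 ?cheb_ge0 // ltW.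
by rewrite -hr rnormM; apply: ler_pM; rewrite ?rnorm_ge0.
Qed.

End Chebyshev.

(** * Convergence of the products of Chebyshev constants *)

Lemma mdimS n r : (r.+1 * mdim n r.+1 = (n + r.+1) * mdim n r)%N.
Proof.
rewrite /mdim -!(bin_sub (leq_addr _ n)) !addKn addnS.
by rewrite mul_bin_diag.
Qed.

Lemma mdim_gt0 n r : (0 < mdim n r)%N.
Proof. by rewrite bin_gt0 leq_addr. Qed.

(** Since [k m_k = (n + k) m_(k-1)], each term [k (m_k - m_(k-1))] equals [n m_(k-1)]. This closed
    form turns [ell]-th roots into means over exponents. *)
Lemma ell_mdim n r : (ell n r * n.+1 = n * r * mdim n r)%N.
Proof.
elim: r => [|r IHr]; first by rewrite /ell big_geq // muln0.
have -> : (ell n r.+1 = ell n r + n * mdim n r)%N.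
  rewrite /ell big_nat_recr //= mulnBr mdimS; congr (_ + _)%N.
  by rewrite -mulnBl addnK.
by rewrite mulnDl IHr -[in RHS]mulnA mdimS; lia.
Qed.

Lemma ell_gt0 n r : (0 < n)%N -> (0 < r)%N -> (0 < ell n r)%N.
Proof.
move=> n0 r0; have := ell_mdim n r; have := mdim_gt0 n r.
by case: (ell n r) => // m0; rewrite mul0n => /esym/eqP; rewrite !muln_eq0 -!leqn0; lia.
Qed.

Section ChebyshevLimit.
Variables (R : realType) (X : Type) (n : nat) (z : 'I_n.+1 -> X -> R[i]).
Hypotheses (n_gt0 : (0 < n)%N) (z_bounded : forall i, ubounded (z i)).

Definition cheb_prod (d : nat) : R := \prod_(a <- comps n.+1 d) cheb z a.

Lemma cheb_prod_ge0 d : 0 <= cheb_prod d.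
Proof. by apply: prodr_ge0 => a _; exact: cheb_ge0. Qed.

(** Multiplication by the [e]-th power of the first function carries a vanishing constant to degree
    [d + e]. *)
Lemma cheb_prod0 d e : cheb_prod d = 0 -> cheb_prod (d + e) = 0.
Proof.
move/eqP; rewrite prodf_seq_eq0 => /hasP[a ad /= /eqP cheb0].
have be : e :: nseq n 0%N \in comps n.+1 e.
  by rewrite mem_comps /= size_nseq sumn_nseq mul0n addn0 !eqxx.
apply/eqP; rewrite prodf_seq_eq0; apply/hasP; exists (addseq a (e :: nseq n 0%N)).
  exact: mem_addseq.
rewrite /= eq_le cheb_ge0 andbT -(mul0r (cheb z (e :: nseq n 0%N))) -cheb0.
move: ad be; rewrite !mem_comps => /andP[/eqP sa _] /andP[/eqP sb _].
exact: cheb_submul.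
Qed.

Lemma cvg_cheb_prod : cvgn (fun d => cheb_prod d `^ (ell n d)%:R^-1).
Proof.
(* One vanishing product makes the sequence eventually 0; otherwise every Chebyshev constant is
   positive and logarithms are available. *)
have [[d0 Pd0]|/forallNP PN0] := pselect (exists d, cheb_prod d = 0).
  apply/cvg_ex; exists 0; apply: cvg_near_cst; near=> d.
  have d0d : (d0 <= d)%N by near: d; exact: nbhs_infty_ge.
  rewrite -(subnKC d0d) cheb_prod0 // powR0 // invr_neq0 // pnatr_eq0 -lt0n.
  by rewrite ell_gt0 // subnKC //; near: d; exact: nbhs_infty_gt.
have cheb_gt0 d a : a \in comps n.+1 d -> 0 < cheb z a.
  move=> ad; rewrite lt_neqAle cheb_ge0 andbT eq_sym; apply/negP => /eqP c0.
  apply: (PN0 d); apply/eqP; rewrite prodf_seq_eq0; apply/hasP.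
  by exists a => //=; rewrite c0.
pose f a := ln (cheb z a).
(* The factor comes from [ell = n d m_d / (n + 1)]: it makes [A d / d] the logarithm of the [ell]-th
   root. *)
pose A d := n.+1%:R / n%:R * comps_mean n f d.
have subA d e : A (d + e)%N <= A d + A e.
  rewrite -mulrDr ler_wpM2l ?divr_ge0 //; apply: comps_mean_sub => p q a b ap bq.
  move: (ap) (bq); rewrite !mem_comps => /andP[/eqP sa _] /andP[/eqP sb _].
  rewrite -lnM ?posrE ?(cheb_gt0 _ _ ap) ?(cheb_gt0 _ _ bq) //.
  rewrite ler_ln ?posrE ?mulr_gt0 ?(cheb_gt0 _ _ ap) ?(cheb_gt0 _ _ bq) //.
    exact: cheb_submul.
  exact: cheb_gt0 (mem_addseq ap bq).
have /cvg_ex[l cvgl] := fekete_expR subA; apply/cvg_ex; exists l.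
apply: cvg_trans cvgl; apply: near_eq_cvg; near=> d.
have d0 : (0 < d)%N by near: d; exact: nbhs_infty_gt.
have -> : cheb_prod d = expR (\sum_(a <- comps n.+1 d) f a).
  rewrite expR_sum /cheb_prod big_seq [RHS]big_seq; apply: eq_bigr => a ad.
  by rewrite lnK // posrE (cheb_gt0 _ _ ad).
rewrite -expRM; congr expR; rewrite /A /comps_mean.
have natr0 p : (0 < p)%N -> p%:R != 0 :> R by rewrite pnatr_eq0 lt0n.
have mE : 'C(d + n, n) = mdim n d by rewrite addnC.
have -> : (ell n d)%:R = n%:R * d%:R * (mdim n d)%:R / n.+1%:R :> R.
  by apply: (canRL (mulfK _)); rewrite ?natr0 // -!natrM ell_mdim.
by rewrite mE; field; rewrite nat1r !natr0 ?mdim_gt0.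
Unshelve. all: by end_near. Qed.

End ChebyshevLimit.

(** * Factorials, sandwiches and roots *)

Section Factorials.
Variable R : realType.

Lemma cvg_lnS_div : ln d.+1%:R / d%:R @[d --> \oo] --> (0 : R).
Proof.
apply/cvgrPdist_lt => e e0; near=> d.
have d0 : (0 < d)%N by near: d; exact: nbhs_infty_gt.
have large : (4 / e) ^+ 2 < d.+1%:R.
  apply: (@lt_trans _ _ d%:R); last by rewrite ltr_nat.
  by near: d; exact: nbhs_infty_gtr.
(* [ln (d + 1) = 2 ln t <= 2 t], while [t e > 4] and [t^2 <= 2 d] give [2 t < e d]. *)
pose t := Num.sqrt (d.+1%:R : R).
have t2 : t ^+ 2 = d.+1%:R by rewrite sqr_sqrtr.
have t0 : 0 < t by rewrite sqrtr_gt0.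
have lt_t : 4 / e < t.
  by rewrite -(@ltr_pXn2r _ 2) ?nnegrE ?t2 ?ltW // divr_gt0.
have lnle : ln d.+1%:R <= 2 * t.
  have -> : ln d.+1%:R = 2 * ln t by rewrite -t2 lnXn // mulr_natl.
  by rewrite ler_wpM2l // ltW // ln_sublinear.
have d0' : 0 < d%:R :> R by rewrite ltr0n.
rewrite sub0r normrN ger0_norm; last by rewrite divr_ge0 // ln_ge0 // ler1n.
rewrite ltr_pdivrMr // (le_lt_trans lnle) //.
have td : t ^+ 2 <= 2 * d%:R by rewrite t2 -natrM ler_nat; lia.
have : 4 < t * e by rewrite -ltr_pdivrMr.
nra.
Unshelve. all: by end_near. Qed.

Lemma mdim_le n r : (mdim n r <= r.+1 ^ n)%N.
Proof.
elim: n => [|n IHn]; first by rewrite /mdim bin0.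
have nr : (n.+1 + r <= n.+1 * r.+1)%N by lia.
rewrite -(leq_pmul2l (ltn0Sn n)) /mdim -mul_bin_diag expnS mulnA.
exact: leq_mul.
Qed.

Lemma fact_le_exp m : (m`! <= m ^ m)%N.
Proof.
elim: m => // m IHm; rewrite factS expnS leq_mul2l /= (leq_trans IHm) //.
by case: m {IHm} => // m; rewrite leq_exp2r.
Qed.

Lemma cvg_fact_powR n s : (0 < n)%N -> (0 < s)%N ->
  ((s * mdim n r)`!%:R : R) `^ (s * ell n r)%:R^-1 @[r --> \oo] --> (1 : R).
Proof.
move=> n0 s0.
(* From [N! <= N^N] and [N <= s (r + 1)^n], the logarithm of the root is at most
   [(n + 1) / (n r) * (ln s + n ln (r + 1))]. *)
pose g r := n.+1%:R / n%:R * (ln s%:R / r%:R + n%:R * (ln r.+1%:R / r%:R)) : R.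
have cvg_g : expR (g r) @[r --> \oo] --> (1 : R).
  rewrite -(@expR0 R); apply: continuous_cvg; first exact: continuous_expR.
  rewrite -(mulr0 (n.+1%:R / n%:R)); apply: cvgMr.
  rewrite -(addr0 0); apply: cvgD; first exact: cvg_divn.
  by rewrite -(mulr0 n%:R); apply: cvgMr; exact: cvg_lnS_div.
apply: (@squeeze_cvgr _ _ _ R (fun=> 1) (expR \o g));
  [|exact: cvg_cst|exact: cvg_g].
near=> r.
have r0 : (0 < r)%N by near: r; exact: nbhs_infty_gt.
set N := (s * mdim n r)%N; have N0 : (0 < N)%N by rewrite muln_gt0 s0 mdim_gt0.
have l0 := ell_gt0 n0 r0.
have F1 : 1 <= (N`!%:R : R) by rewrite ler1n fact_gt0.
rewrite -{1}(powRr0 (N`!%:R)) ler_powR //=.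
rewrite -[X in X `^ _]lnK ?posrE ?ltr0n ?fact_gt0 // -expRM ler_expR.
have q0 : 0 < ((s * ell n r)%:R : R) by rewrite ltr0n muln_gt0 s0.
rewrite ler_pdivrMr //.
have -> : g r * (s * ell n r)%:R = N%:R * (ln s%:R + n%:R * ln r.+1%:R).
  have natr0 p : (0 < p)%N -> p%:R != 0 :> R by rewrite pnatr_eq0 lt0n.
  have -> : (s * ell n r)%:R = s%:R * (n%:R * r%:R * (mdim n r)%:R / n.+1%:R) :> R.
    by rewrite natrM; congr (_ * _); apply: (canRL (mulfK _));
       rewrite ?natr0 // -!natrM ell_mdim.
  by rewrite /g /N natrM; field; rewrite nat1r !natr0 ?mdim_gt0.
apply: (@le_trans _ _ (ln (N ^ N)%:R)).
  by rewrite ler_ln ?posrE ?ltr0n ?fact_gt0 ?expn_gt0 ?N0 // ler_nat fact_le_exp.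
rewrite natrX lnXn ?ltr0n // -[leLHS]mulr_natl ler_wpM2l //.
rewrite [n%:R * _]mulr_natl -lnXn // -lnM ?posrE ?exprn_gt0 ?ltr0n //.
rewrite ler_ln ?posrE ?mulr_gt0 ?exprn_gt0 ?ltr0n // -natrX -natrM ler_nat.
by rewrite leq_mul2l mdim_le orbT.
Unshelve. all: by end_near. Qed.

(* Every quantity of the theorem is pinned between [P r] and [N! P r] with [N] of
   polynomial growth, so that the exponent [1 / ell] absorbs the factorial. *)
Lemma cvg_root_sandwich n s (P D : nat -> R) (l : R) : (0 < n)%N -> (0 < s)%N ->
  (forall r, 0 <= P r) ->
  (forall r, P r <= D r <= (s * mdim n r)`!%:R * P r) ->
  P r `^ (s * ell n r)%:R^-1 @[r --> \oo] --> l ->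
  D r `^ (s * ell n r)%:R^-1 @[r --> \oo] --> l.
Proof.
move=> n0 s0 P0 PD cvgP.
have cvgFP : ((s * mdim n r)`!%:R * P r) `^ (s * ell n r)%:R^-1
    @[r --> \oo] --> l.
  under eq_fun do rewrite powRM //.
  by rewrite -(mul1r l); apply: cvgM => //; exact: cvg_fact_powR.
apply: squeeze_cvgr cvgP cvgFP; near=> r.
have /andP[le1 le2] := PD r; have D0 := le_trans (P0 r) le1.
by rewrite !ge0_ler_powR ?nnegrE ?invr_ge0 // mulr_ge0.
Unshelve. all: by end_near. Qed.

Lemma cvg_powR (v : nat -> R) (l p : R) : 0 < p -> (forall r, 0 <= v r) ->
  v r @[r --> \oo] --> l -> v r `^ p @[r --> \oo] --> l `^ p.
Proof.
move=> p0 v0 cvgv; have l0 : 0 <= l by apply: (cvgr_to_ge cvgv); near=> r.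
(* At the limit 0 the power is not [expR (p * ln l)]; there [v r < e ^ (1 / p)] suffices. *)
move: l0; rewrite le_eqVlt => /predU1P[l0|l0].
  rewrite -l0 powR0 ?gt_eqF //; apply/cvgrPdist_lt => e e0; near=> r.
  rewrite sub0r normrN ger0_norm ?powR_ge0 //.
  rewrite -[ltRHS](powRr1 (ltW e0)) -(mulVf (lt0r_neq0 p0)) powRrM.
  rewrite gt0_ltr_powR ?nnegrE ?powR_ge0 //.
  by near: r; apply: (cvgr_lt _ cvgv); rewrite -l0 powR_gt0.
have -> : l `^ p = expR (p * ln l) by rewrite /powR gt_eqF.
have cvge : expR (p * ln (v r)) @[r --> \oo] --> expR (p * ln l).
  apply: continuous_cvg; first exact: continuous_expR.
  by apply: cvgMr; apply: continuous_cvg cvgv; exact: continuous_ln.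
apply: cvg_trans cvge; apply: near_eq_cvg; near=> r.
by rewrite /powR gt_eqF //; near: r; apply: (cvgr_gt _ cvgv).
Unshelve. all: by end_near. Qed.

Lemma powR_prod (I : Type) (q : seq I) (F : I -> R) (p : R) :
  (forall i, 0 <= F i) -> (\prod_(i <- q) F i) `^ p = \prod_(i <- q) F i `^ p.
Proof.
move=> F0; elim: q => [|i q IHq]; first by rewrite !big_nil powR1.
by rewrite !big_cons powRM ?prodr_ge0 // IHq.
Qed.

End Factorials.

(** * Continuous functions on a compact set are bounded *)

Section Boundedness.
Variable R : realType.

Lemma rnorm_continuous (V : normedModType R[i]) : continuous (@rnorm R V).
Proof.
move=> v; apply/cvgrPdist_lt => e e0.
have e0' : 0 < e%:C by rewrite ltcR.
have := @cvg_id _ (nbhs v); move/cvgrPdist_lt => /(_ _ e0'); apply: filterS => y.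
rewrite -rnormE ltcR; apply: le_lt_trans.
have le_v : rnorm v <= rnorm (v - y) + rnorm y by rewrite -{1}(subrK y v) rnormD.
have le_y : rnorm y <= rnorm (v - y) + rnorm v.
  by rewrite -{1}(subrK v y) -(rnormN (v - y)) opprB rnormD.
by rewrite ler_norml; apply/andP; split; lra.
Qed.

Lemma compact_ubounded (T : topologicalType) (K : set T) (V : normedModType R[i])
    (f : K -> V) : compact K -> continuous f ->
  exists M : R, forall x, rnorm (f x) <= M.
Proof.
move=> cK cf; pose g (x : K) : R := rnorm (f x).
have cg : continuous g.
  move=> x; apply: (@continuous_comp _ _ _ f (@rnorm R V)); first exact: cf.
  exact: rnorm_continuous.
(* Compactness is that of [K] as a subset of [T], so [g] is extended by 0 and seen as continuous on
   the subspace [K]. *)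
have /subspace_valL_continuousP' cgK := cg.
have /compact_bounded [M [_ hM]] := continuous_compact (cgK 0) cK.
exists (M + 1) => x; apply: le_trans (ler_norm _) _.
have <- : 'valL_(0 : R) g (set_val x) = rnorm (f x).
  exact: (congr1 (fun g' => g' x) (valLK _ g)).
apply: hM; first by rewrite ltrDl.
by exists (set_val x) => //; exact: set_valP.
Qed.

End Boundedness.

(** * The scalar transfinite diameter *)

Section HomogeneousExponents.
Variables n r : nat.

(** Homogenisation: the first entry is the degree missing to [r], a subtraction made exact by
    [alpha_le]. *)
Definition hexp (j : 'I_(mdim n r)) : seq nat :=
  (r - \sum_(i <- alpha j) i)%N :: [seq nat_of_ord i | i <- alpha j].

Lemma alpha_le (j : 'I_(mdim n r)) : (\sum_(i <- alpha j) i <= r)%N.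
Proof.
have := enum_valP (cast_ord (esym (card_partial_ord_partitions n r)) j).
by rewrite finset.in_set.
Qed.

Lemma alpha_inj : injective (@alpha n r).
Proof. by move=> i j /enum_val_inj/cast_ord_inj. Qed.

Lemma hexp_comps j : hexp j \in comps n.+1 r.
Proof.
rewrite mem_comps /= size_map size_tuple eqxx /= sumnE big_map.
by rewrite subnK ?alpha_le.
Qed.

Lemma hexp_inj : injective hexp.
Proof.
move=> i j [_ /(inj_map val_inj)] eq_ij; apply: alpha_inj.
exact: val_inj.
Qed.

(** [hexp] is injective and there are as many indices as exponents, so it enumerates all of degree
    [r]. *)
Lemma big_hexp (V : Type) (idx : V) (op : Monoid.com_law idx)
    (P : pred (seq nat)) (F : seq nat -> V) :
  \big[op/idx]_(a <- comps n.+1 r | P a) F a =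
  \big[op/idx]_(j | P (hexp j)) F (hexp j).
Proof.
rewrite (perm_big [seq hexp j | j <- enum 'I_(mdim n r)]).
  by rewrite big_map big_enum_cond.
rewrite perm_sym.
have uniq_hexp : uniq [seq hexp j | j <- enum 'I_(mdim n r)].
  by rewrite map_inj_uniq ?enum_uniq //; exact: hexp_inj.
apply: uniq_perm; rewrite ?uniq_comps //.
have [] := @uniq_min_size _ _ (comps n.+1 r) uniq_hexp _ _ => //.
  by move=> _ /mapP[j _ ->]; exact: hexp_comps.
by rewrite size_map size_enum_ord size_comps /mdim addnC.
Qed.

End HomogeneousExponents.

(** * Weighted polynomials as homogeneous polynomials *)

Section HomogeneousCoordinates.
Variables (R : realType) (n : nat) (K : set 'rV[R[i]]_n).
Hypothesis K_compact : compact K.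
Variable omega : K -> R.
Hypotheses (omega_cont : continuous omega) (omega_ge0 : forall x, 0 <= omega x).

(* The polynomials of degree at most [r], multiplied by [omega ^ r], become the
   homogeneous polynomials of degree [r] in these [n + 1] functions. *)
Definition hcoord (i : 'I_n.+1) (x : K) : R[i] :=
  if unlift ord0 i is Some k
  then (omega x)%:C * (set_val x : 'rV[R[i]]_n) 0 k else (omega x)%:C.

Lemma mon_hexp r (j : 'I_(mdim n r)) x :
  mon hcoord (hexp j) x = monom j (set_val x : 'rV[R[i]]_n) * (omega x ^+ r)%:C.
Proof.
rewrite /mon big_ord_recl /hcoord unlift_none.
under eq_bigr do rewrite liftK lift0 exprMn.
rewrite /hexp /=.
rewrite big_split /= mulrA mulrC /monom; congr (_ * _).
  apply: eq_bigr => i _; congr (_ ^+ _).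
  by rewrite (nth_map ord0) ?size_tuple // -tnth_nth.
rewrite -expr_sum -exprD -rmorphXn; congr (_ ^+ _)%:C.
rewrite (eq_bigr (fun i => nat_of_ord (tnth (alpha j) i))); last first.
  by move=> i _; rewrite (nth_map ord0) ?size_tuple // -tnth_nth.
by rewrite -(big_tuple _ _ (alpha j) xpredT (fun i => nat_of_ord i)) subnK ?alpha_le.
Qed.

(** Passes between coefficients indexed by lists and by the columns of the determinant. *)
Lemma lower_hexp r (j : 'I_(mdim n r)) (q : K -> R[i]) :
  lower hcoord (hexp j) q <-> exists b : 'I_(mdim n r) -> R[i],
    forall x, q x = \sum_(i | lexlt (hexp i) (hexp j)) b i * mon hcoord (hexp i) x.
Proof.
have sumr : sumn (hexp j) = r.
  by have := hexp_comps j; rewrite mem_comps => /andP[_ /eqP].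
split=> [[g qg]|[b qb]].
  by exists (g \o @hexp n r) => x; rewrite qg sumr big_hexp.
rewrite (funext qb); apply: lower_sum => i _ lt_ij; apply: lowerZ.
by apply: lower_mon => //; rewrite sumr hexp_comps.
Qed.

Lemma hcoord_continuous i : continuous (hcoord i).
Proof.
have cO : continuous (fun x => (omega x)%:C).
  move=> x; apply: (@continuous_comp _ _ _ omega (real_complex R)).
    exact: omega_cont.
  exact: real_complex_continuous.
rewrite /hcoord; case: (unlift ord0 i) => [k|] //.
move=> x; apply: (@continuousM R[i] K (fun y => (omega y)%:C)
  (fun y => (set_val y : 'rV[R[i]]_n) 0 k)); first exact: cO.
apply: (@continuous_comp _ _ _ set_val (fun y : 'rV[R[i]]_n => y 0 k)).
  exact: initial_continuous.
exact: coord_continuous.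
Qed.

Lemma hcoord_bounded i : ubounded (hcoord i).
Proof. exact: (compact_ubounded K_compact (@hcoord_continuous i)). Qed.

Lemma cheb_prod_hexp r :
  cheb_prod hcoord r = \prod_(j < mdim n r) cheb hcoord (hexp j).
Proof. by rewrite /cheb_prod big_hexp. Qed.

(** Row [i] of the Vandermonde matrix absorbs [omega (x i) ^ r]. *)
Lemma rnorm_vdm r (x : 'I_(mdim n r) -> K) :
  rnorm (vdm (fun i => set_val (x i))) * \prod_i omega (x i) ^+ r =
  rnorm (\det (\matrix_(i, j) mon hcoord (hexp j) (x i))).
Proof.
have -> : \matrix_(i, j < mdim n r) mon hcoord (hexp j) (x i) =
    diag_mx (\row_i (omega (x i) ^+ r)%:C) *m
    \matrix_(i, j < mdim n r) monom j (set_val (x i) : 'rV[R[i]]_n).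
  apply/matrixP => i j; by rewrite mul_diag_mx !mxE mon_hexp mulrC.
rewrite det_mulmx rnormM mulrC det_diag rnorm_prod; congr (_ * _).
by apply: eq_bigr => i _; rewrite mxE rnorm_real // exprn_ge0.
Qed.

Definition vdm_sup r : R :=
  sup [set rnorm (vdm (fun i => set_val (x i))) * \prod_i omega (x i) ^+ r
      | x in [set: 'I_(mdim n r) -> K]].

Lemma vdm_sup_bounds r :
  cheb_prod hcoord r <= vdm_sup r <= (mdim n r)`!%:R * cheb_prod hcoord r.
Proof.
rewrite /vdm_sup; set E := [set _ | _ in _]; set W := sup E.
have E_ub x : E x -> x <= (mdim n r)`!%:R * cheb_prod hcoord r.
  move=> [y _ <-]; rewrite rnorm_vdm cheb_prod_hexp.
  apply: (@det_le_chebyshev _ _ (seqlexi nat) _ (@hexp n r)) => e e0 j.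
  have [q /lower_hexp[b qb] hq] := cheb_approx hcoord_bounded (hexp j) e0.
  exists b => k; rewrite !mxE; have := hq (y k); rewrite qb.
  by under [in X in _ -> X]eq_bigr do rewrite mxE.
have hubE : has_ubound E by exists ((mdim n r)`!%:R * cheb_prod hcoord r).
have W0 : 0 <= W.
  rewrite /W; have [[[v Ev] _]|/sup_out ->//] := pselect (has_sup E).
  apply: le_trans (ub_le_sup hubE Ev); case: Ev => y _ <-.
  by rewrite rnorm_vdm rnorm_ge0.
apply/andP; split.
  rewrite cheb_prod_hexp; apply: prodr_ge_approx => // [j|c c0 c_lt].
    exact: cheb_ge0.
  have [|y hy] := @det_ge_chebyshev R _ (seqlexi nat) K _ (@hexp n r)
    (fun j => mon hcoord (hexp j)) c (@hexp_inj n r) c0.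
    move=> j b.
    have low : lower hcoord (hexp j)
        (fun x => \sum_(i | lexlt (hexp i) (hexp j)) b i * mon hcoord (hexp i) x).
      by apply/lower_hexp; exists b.
    exact: cheb_gt (c0 j) (c_lt j) low.
  apply: (le_trans hy); apply: ub_le_sup => //; exists y => //.
  exact: rnorm_vdm.
rewrite /W; have [->|/set0P E0] := eqVneq E set0.
  by rewrite sup0 mulr_ge0 // cheb_prod_ge0.
exact: ge_sup.
Qed.

Hypothesis n_gt0 : (0 < n)%N.

Lemma cvg_scalar_diam : cheb_prod hcoord r `^ (ell n r)%:R^-1 @[r --> \oo] -->
  transfinite_diam omega.
Proof.
have /cvg_ex[l cvgP] := cvg_cheb_prod n_gt0 hcoord_bounded.
suff cvgW : scalar_diam omega r @[r --> \oo] --> l.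
  by rewrite /transfinite_diam (cvg_lim _ cvgW).
(* The scalar case is the sandwich with [s = 1]. *)
have := @cvg_root_sandwich R n 1 (cheb_prod hcoord) vdm_sup l n_gt0 isT.
have -> : (fun r => vdm_sup r `^ (1 * ell n r)%:R^-1) = scalar_diam omega.
  by apply/funext => r; rewrite mul1n.
have -> : (fun r => cheb_prod hcoord r `^ (1 * ell n r)%:R^-1) =
    (fun r => cheb_prod hcoord r `^ (ell n r)%:R^-1).
  by apply/funext => r; rewrite mul1n.
apply => // r; first exact: cheb_prod_ge0.
by rewrite mul1n; exact: vdm_sup_bounds.
Qed.

End HomogeneousCoordinates.

(** * The weighted diameter *)

Section BlockIndices.
Variables n s r : nat.
Local Notation m := (mdim n r).

(** The same decoding of indices as in [qpoly]. *)
Definition block_index (k : 'I_(s * m)) : 'I_s * 'I_m :=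
  enum_val (cast_ord (esym (mxvec_cast s m)) k).

Definition block_key (k : 'I_(s * m)) : seq nat :=
  nat_of_ord (block_index k).1 :: hexp (block_index k).2.

Lemma block_index_bij : bijective block_index.
Proof.
exists (fun p => cast_ord (mxvec_cast s m) (enum_rank p)) => [k|p].
  by rewrite /block_index enum_valK cast_ordKV.
by rewrite /block_index cast_ordK enum_rankK.
Qed.

Lemma block_key_inj : injective block_key.
Proof.
move=> k k' [/val_inj eq1 ] eq2 eq3; apply: (bij_inj block_index_bij).
rewrite [LHS]surjective_pairing [RHS]surjective_pairing eq1; congr (_, _).
by apply: (@hexp_inj n r); rewrite /hexp eq2 eq3.
Qed.

Lemma big_block (V : Type) (idx : V) (op : Monoid.com_law idx)
    (F : 'I_s -> 'I_m -> V) :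
  \big[op/idx]_k F (block_index k).1 (block_index k).2 =
  \big[op/idx]_l \big[op/idx]_j F l j.
Proof. by rewrite pair_bigA /= [RHS](reindex _ (onW_bij _ block_index_bij)). Qed.

(** Inside one block the heads of the keys agree and only exponents are compared. With coefficients
    0 in the other blocks, a lower combination for one weight is one for the whole family. *)
Lemma sum_block_lower (V : zmodType) (F : 'I_s -> 'I_m -> V) (k : 'I_(s * m)) :
  \sum_(k' | lexlt (block_key k') (block_key k))
     (if (block_index k').1 == (block_index k).1
      then F (block_index k').1 (block_index k').2 else 0) =
  \sum_(j | lexlt (hexp j) (hexp (block_index k).2)) F (block_index k).1 j.
Proof.
set l0 := (block_index k).1; set j0 := (block_index k).2.
pose G l j := if lexlt (nat_of_ord l :: hexp j) (nat_of_ord l0 :: hexp j0)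
  then if l == l0 then F l j else 0 else 0.
rewrite big_mkcond -/(\sum_k' G (block_index k').1 (block_index k').2).
rewrite (big_block _ G) (bigD1 l0) //= [X in _ + X]big1 ?addr0; last first.
  move=> l /negPf l_neq; apply: big1 => j _.
  by rewrite /G l_neq if_same.
rewrite [RHS]big_mkcond; apply: eq_bigr => j _.
by rewrite /G lexlt_cons ltnn !eqxx.
Qed.

End BlockIndices.

(** * Functionals of norm one *)

Section Functionals.
Variables (R : realType) (T : topologicalType) (K : set T) (V : normedModType R[i]).
Hypothesis K_compact : compact K.
Local Notation C0 := (continuousType K V).
Implicit Types f : C0.

Lemma supnorm_ub f x : rnorm (f x) <= supnorm f.
Proof.
have [M fM] := compact_ubounded K_compact (@cts_fun _ _ f).
by apply: ub_le_sup; [exists M => _ [y _ <-]; exact: fM|exists x].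
Qed.

Lemma supnorm_le f M : 0 <= M -> (forall x, rnorm (f x) <= M) -> supnorm f <= M.
Proof.
move=> M0 fM; rewrite /supnorm; set E := (E in sup E).
have [->|/set0P E0] := eqVneq E set0; first by rewrite sup0.
by apply: ge_sup => // _ [x _ <-]; exact: fM.
Qed.

Lemma supnorm_ge0 f : 0 <= supnorm f.
Proof.
rewrite /supnorm; set E := (E in sup E).
have [[[y [x _ fx]] _]|/sup_out ->//] := pselect (has_sup E).
by apply: le_trans (supnorm_ub f x); exact: rnorm_ge0.
Qed.

Lemma opnorm_le (L : {scalar C0}) f :
  bounded_functional L -> opnorm L = 1 -> rnorm (L f) <= supnorm f.
Proof.
move=> [M LM] L1; have := supnorm_ge0 f; rewrite le_eqVlt => /predU1P[f0|f0].
  (* A function of norm 0 cannot be normalised; boundedness of [L] gives [L f = 0]. *)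
  by rewrite (le_trans (LM f)) // -f0 mulr0.
pose g : C0 := (supnorm f)^-1%:C *: f.
have g1 : supnorm g <= 1.
  apply: supnorm_le => // x.
  have -> : g x = (supnorm f)^-1%:C *: f x by [].
  rewrite rnormZ rnorm_real ?invr_ge0 ?(ltW f0) // mulrC ler_pdivrMr // mul1r.
  exact: supnorm_ub.
have : rnorm (L g) <= 1.
  rewrite -L1; apply: ub_le_sup; last by exists g.
  exists `|M| => _ [f' f'1 <-]; apply: (le_trans (LM f')).
  apply: (@le_trans _ _ (`|M| * supnorm f')).
    by rewrite ler_wpM2r ?supnorm_ge0 // ler_norm.
  by rewrite -[leRHS]mulr1 ler_wpM2l.
rewrite linearZ /= rnormM rnorm_real ?invr_ge0 ?(ltW f0) // mulrC ler_pdivrMr //.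
by rewrite mul1r.
Qed.

End Functionals.

Section EvalCoord.
Context {R : realType} {T : topologicalType} {U : vectType R[i]}
  (h : {dot U for conjC}) (s : nat) (u : s.-tuple U).

(** The test functionals for the lower bound of the weighted diameter. *)
Definition eval_coord (l : 'I_s) (x : T) (f : continuousType T (hermspace h)) : R[i] :=
  coord u l (f x).

Lemma eval_coord_is_linear l x : linear_for *%R (eval_coord l x).
Proof.
move=> a f g; rewrite /eval_coord.
have -> : (a *: f + g) x = a *: f x + g x by [].
exact: (linearP (coord u l)).
Qed.

HB.instance Definition _ l x :=
  GRing.isLinear.Build R[i] (continuousType T (hermspace h)) R[i] *%R
    (eval_coord l x) (eval_coord_is_linear l x).

End EvalCoord.

(** * Bounds for the determinants of functionals *)

Section WeightedBounds.
Variables (R : realType) (n s : nat) (K : set 'rV[R[i]]_n).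
Hypothesis K_compact : compact K.
Variables (U : vectType R[i]) (h : {dot U for conjC}) (u : s.-tuple U).
Hypotheses (u_basis : basis_of fullv u) (u_orthonormal : orthonormal h u).
Variable w : 'I_s -> continuousType K R.
Local Notation C0 := (continuousType K (hermspace h)).
Local Notation z l := (hcoord (w l)).

Let w_cont l : continuous (w l).
Proof. exact: (@cts_fun _ _ (w l)). Qed.

Let z_bounded l i : ubounded (z l i).
Proof. exact: hcoord_bounded. Qed.

Lemma coord_u i j : coord u i (tnth u j) = (j == i)%:R.
Proof. by rewrite (tnth_nth 0) coord_free // (basis_free u_basis). Qed.

Lemma rnorm_u l : rnorm (tnth u l : hermspace h) = 1.
Proof.
have /orthonormalP[_ hu] := u_orthonormal.
have -> : rnorm (tnth u l : hermspace h) =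
  complex.Re (sqrtC (h (tnth u l) (tnth u l))) by [].
by rewrite hu ?mem_tnth // eqxx sqrtC1.
Qed.

(** In an orthonormal basis the coordinate is [h v u_l], so Cauchy-Schwarz applies. *)
Lemma rnorm_coord_le l (v : hermspace h) : rnorm (coord u l v) <= rnorm v.
Proof.
have /orthonormalP[uniq_u hu] := u_orthonormal.
have hterm i : h (coord u i v *: u`_i) (tnth u l) = coord u i v * (i == l)%:R.
  transitivity (coord u i v * h (tnth u i) (tnth u l)).
    by rewrite -tnth_nth; exact: linearZl_LR.
  rewrite hu ?mem_tnth // (tnth_nth 0) [X in _ == X](tnth_nth 0).
  by rewrite nth_uniq ?size_tuple.
have hvu : h v (tnth u l) = coord u l v.
  rewrite {1}(coord_basis u_basis (memvf (v : U))) linear_sumlz.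
  transitivity (\sum_i coord u i v * (i == l)%:R).
    by apply: eq_bigr => i _; exact: hterm.
  rewrite (bigD1 l) //= eqxx mulr1 big1 ?addr0 // => i il.
  by rewrite (negPf il) mulr0.
have [+ _] := CauchySchwarz h v (tnth u l).
rewrite hvu (hu _ _ (mem_tnth l u) (mem_tnth l u)) eqxx mulr1 => le2.
rewrite -lecR !rnormE.
have -> : `|v| = sqrtC (h v v) by [].
by rewrite -(@ler_pXn2r _ 2) ?nnegrE ?normr_ge0 ?sqrtC_ge0 ?dnorm_ge0 // sqrtCK.
Qed.

(** [odot] of distinct basis vectors vanishes, so only the weight of the block survives. *)
Lemma qwE r (k : 'I_(s * mdim n r)) x :
  qw h u w k x =
  mon (z (block_index k).1) (hexp (block_index k).2) x *: tnth u (block_index k).1.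
Proof.
set l := (block_index k).1; set j := (block_index k).2.
have -> : qw h u w k x =
  odot u (monom j (set_val x : 'rV[R[i]]_n) *: tnth u l) (wpow u w r x) by [].
rewrite mon_hexp /odot (bigD1 l) //= big1 ?addr0 => [|i il].
  rewrite linearZ /= coord_u eqxx mulr1 /wpow linear_sum (bigD1 l) //= big1 ?addr0.
    by rewrite linearZ /= coord_u eqxx mulr1.
  by move=> i il; rewrite linearZ /= coord_u (negPf il) mulr0.
by rewrite linearZ /= coord_u eq_sym (negPf il) mulr0 mul0r scale0r.
Qed.

Lemma cts_sumE (I : Type) (q : seq I) (P : pred I) (F : I -> C0) x :
  (\sum_(i <- q | P i) F i) x = \sum_(i <- q | P i) F i x.
Proof. by apply: (big_morph (fun f : C0 => f x)). Qed.

Lemma prod_cheb_block r :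
  \prod_(k < s * mdim n r) cheb (z (block_index k).1) (hexp (block_index k).2) =
  \prod_l cheb_prod (z l) r.
Proof.
rewrite (big_block _ (fun l j => cheb (z l) (hexp j))).
by apply: eq_bigr => l _; rewrite cheb_prod_hexp.
Qed.

Definition det_sup r : R :=
  sup [set rnorm (\det (\matrix_(i, j) T i (qw h u w j)))
      | T in [set T : 'I_(s * mdim n r) -> {scalar C0}
             | forall i, bounded_functional (T i) /\ opnorm (T i) = 1]].

Lemma det_functionals_le r (T : 'I_(s * mdim n r) -> {scalar C0}) :
  (forall i, bounded_functional (T i) /\ opnorm (T i) = 1) ->
  rnorm (\det (\matrix_(i, j) T i (qw h u w j))) <=
  (s * mdim n r)`!%:R * \prod_l cheb_prod (z l) r.
Proof.
move=> T1; rewrite -prod_cheb_block.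
apply: (@det_le_chebyshev _ _ (seqlexi nat) _ (@block_key n s r)) => e e0 k.
set l := (block_index k).1; set j := (block_index k).2.
have [q /lower_hexp[b qb] hq] := cheb_approx (z_bounded l) (hexp j) e0.
(* With coefficients 0 outside the block of [k], [f] is a near-minimal polynomial times the unit
   vector [u_l]. *)
pose b' k' := if (block_index k').1 == l then b (block_index k').2 else 0.
exists b' => i.
pose f : C0 := qw h u w k +
  \sum_(k' | lexlt (block_key k') (block_key k)) b' k' *: qw h u w k'.
have -> : (\matrix_(i, j) T i (qw h u w j)) i k +
    \sum_(k' | lexlt (block_key k') (block_key k))
      b' k' * (\matrix_(i, j) T i (qw h u w j)) i k' = T i f.
  rewrite mxE /f linearD linear_sum; congr (_ + _); apply: eq_bigr => k' _.
  by rewrite mxE linearZ.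
have [T_bnd T_1] := T1 i; apply: le_trans (opnorm_le K_compact f T_bnd T_1) _.
apply: supnorm_le => [|x]; first by rewrite addr_ge0 ?cheb_ge0 // ltW.
have -> : f x = (mon (z l) (hexp j) x + q x) *: (tnth u l : hermspace h).
  have -> : f x = qw h u w k x +
      (\sum_(k' | lexlt (block_key k') (block_key k)) b' k' *: qw h u w k') x by [].
  rewrite qwE cts_sumE scalerDl; congr (_ + _).
  rewrite qb scaler_suml -(sum_block_lower (fun l' j' =>
    (b j' * mon (z l') (hexp j') x) *: (tnth u l' : hermspace h))).
  apply: eq_bigr => k' _.
  have -> : (b' k' *: qw h u w k') x = b' k' *: qw h u w k' x by [].
  by rewrite qwE /b'; case: eqP => _; rewrite ?scale0r ?scalerA.
by rewrite rnormZ rnorm_u mulr1 hq.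
Qed.

Lemma eval_coord_bounded l x (f : C0) : rnorm (eval_coord u l x f) <= supnorm f.
Proof. by apply: (le_trans (rnorm_coord_le l (f x))); exact: supnorm_ub. Qed.

Lemma eval_coord_bounded_functional l x :
  bounded_functional (eval_coord u l x : {scalar C0}).
Proof. by exists 1 => f; rewrite mul1r; exact: eval_coord_bounded. Qed.

Lemma opnorm_eval_coord l x : opnorm (eval_coord u l x : {scalar C0}) = 1.
Proof.
(* The constant function [u_l] attains the norm. *)
pose c : C0 := mkcts (@cst_continuous K (hermspace h) (tnth u l)).
have c1 : supnorm c <= 1 by apply: supnorm_le => // y; rewrite /= rnorm_u.
have ub1 : ubound [set rnorm (eval_coord u l x f) | f in [set f : C0 | supnorm f <= 1]] 1.
  by move=> _ [f f1 <-]; exact: le_trans (eval_coord_bounded l x f) f1.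
have mem1 : [set rnorm (eval_coord u l x f) | f in [set f : C0 | supnorm f <= 1]] 1.
  by exists c => //; rewrite /eval_coord /= coord_u eqxx rnorm1.
apply/eqP; rewrite eq_le; apply/andP; split.
  by apply: ge_sup => //; exists 1.
by apply: ub_le_sup => //; exists 1.
Qed.

Lemma det_sup_bounds r :
  \prod_l cheb_prod (z l) r <= det_sup r <=
  (s * mdim n r)`!%:R * \prod_l cheb_prod (z l) r.
Proof.
rewrite /det_sup; set E := [set _ | _ in _].
have P0 : 0 <= \prod_l cheb_prod (z l) r.
  by apply: prodr_ge0 => l _; exact: cheb_prod_ge0.
have E_ub x : E x -> x <= (s * mdim n r)`!%:R * \prod_l cheb_prod (z l) r.
  by move=> [T T1 <-]; exact: det_functionals_le.
have hubE : has_ubound E by eexists; exact: E_ub.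
have E0 : 0 <= sup E.
  have [[[v Ev] _]|/sup_out ->//] := pselect (has_sup E).
  by apply: le_trans (ub_le_sup hubE Ev); case: Ev => T _ <-; exact: rnorm_ge0.
apply/andP; split; last first.
  have [->|/set0P nE] := eqVneq E set0; first by rewrite sup0 mulr_ge0.
  exact: ge_sup.
rewrite -prod_cheb_block; apply: prodr_ge_approx => // [k|c c0 c_lt].
  exact: cheb_ge0.
(* Taking the pairs (weight, point) as the points of a single Chebyshev problem
   makes the matrix block structured without computing with blocks. *)
pose phi (k : 'I_(s * mdim n r)) (p : 'I_s * K) := if (block_index k).1 == p.1
  then mon (z (block_index k).1) (hexp (block_index k).2) p.2 else 0.
have [|y hy] := @det_ge_chebyshev R _ (seqlexi nat) _ _ (@block_key n s r)
    phi c (@block_key_inj n s r) c0.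
  move=> k b; set l := (block_index k).1; set j := (block_index k).2.
  have [g gK Kg] := block_index_bij n s r.
  (* At [(l, x)] the functions [phi] of the other blocks vanish, so only the coefficients of block
     [l] enter; [g] recovers their indices. *)
  pose q x := \sum_(i | lexlt (hexp i) (hexp j)) b (g (l, i)) * mon (z l) (hexp i) x.
  have low : lower (z l) (hexp j) q.
    by apply/lower_hexp; exists (fun i => b (g (l, i))).
  have [x hx] := cheb_gt (c0 k) (c_lt k) low.
  exists (l, x); apply: (le_trans hx); rewrite le_eqVlt; apply/orP; left; apply/eqP.
  congr rnorm; rewrite /phi /= eqxx; congr (_ + _).
  rewrite /q -(sum_block_lower (fun l' i => b (g (l', i)) * mon (z l') (hexp i) x)).
  apply: eq_bigr => k' _; case: eqP => [eq_l|_]; last by rewrite mulr0.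
  by rewrite -surjective_pairing gK.
apply: (le_trans hy); apply: ub_le_sup => //.
(* The chosen pairs become coordinate evaluations, whose matrix on the [qw] is that of [phi]. *)
exists (fun k => eval_coord u (y k).1 (y k).2 : {scalar C0}).
  by move=> k; split; [exact: eval_coord_bounded_functional|exact: opnorm_eval_coord].
congr (rnorm (\det _)); apply/matrixP => i k; rewrite !mxE /= /eval_coord qwE /phi.
rewrite linearZ /= coord_u; case: eqP => _; first by rewrite mulr1.
by rewrite mulr0.
Qed.

End WeightedBounds.

(** * The product formula *)

Theorem theorem2p1 (R : realType) (n s : nat) (hn : (0 < n)%N) (hs : (0 < s)%N)
    (K : set 'rV[R[i]]_n) (K_compact : compact K) (K_nonpp : ~ pluripolar K)
    (U : vectType R[i]) (h : {dot U for conjC}) (u : s.-tuple U)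
    (u_basis : basis_of fullv u) (u_orthonormal : orthonormal h u)
    (w : 'I_s -> continuousType K R)
    (w_pos : forall (l : 'I_s) (x : K), 0 < w l x) :
  cvgn (weighted_diam h u w) /\
  limn (weighted_diam h u w) =
    (\prod_(l < s) transfinite_diam (w l)) `^ s%:R^-1.
Proof.
have w_ge0 l x : 0 <= w l x by exact: ltW.
have w_cont l : continuous (w l) by exact: (@cts_fun _ _ (w l)).
pose P r := \prod_l cheb_prod (hcoord (w l)) r.
pose v l r := cheb_prod (hcoord (w l)) r `^ (ell n r)%:R^-1.
have P_ge0 r : 0 <= P r by apply: prodr_ge0 => l _; exact: cheb_prod_ge0.
have v_ge0 r : 0 <= \prod_l v l r by apply: prodr_ge0 => l _; exact: powR_ge0.
have cvg_v : \prod_l v l r @[r --> \oo] --> \prod_l transfinite_diam (w l).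
  apply: cvg_big => [|l _]; first exact: mul_continuous.
  exact: cvg_scalar_diam.
(* The exponent [1 / (s ell)] splits: the [ell]-th roots converge weight by weight, and the [s]-th
   root is taken last. *)
have PE r : P r `^ (s * ell n r)%:R^-1 = (\prod_l v l r) `^ s%:R^-1.
  rewrite natrM invfM mulrC powRrM; congr (_ `^ _).
  by apply: powR_prod => l; exact: cheb_prod_ge0.
have cvgP : P r `^ (s * ell n r)%:R^-1 @[r --> \oo] -->
    (\prod_l transfinite_diam (w l)) `^ s%:R^-1.
  under eq_fun do rewrite PE.
  by apply: cvg_powR => //; rewrite invr_gt0 ltr0n.
have cvgD : weighted_diam h u w r @[r --> \oo] -->
    (\prod_l transfinite_diam (w l)) `^ s%:R^-1.
  apply: (@cvg_root_sandwich R n s P (det_sup h u w)) => // r.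
  exact: (det_sup_bounds K_compact u_basis u_orthonormal w).
by split; [apply/cvg_ex; eexists; exact: cvgD|exact: cvg_lim].
Qed.
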